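(* Let $F$ be an absolutely continuous df with pdf $f$, let $k$ be a positive integer, and let $F_k(x)=F(x)\sum_{i=0}^{k-1}\frac{(-\ln F(x))^i}{i!}$ for $x$ with $F(x)>0$, and $F_k(x)=0$ when $F(x)=0$. Then the following hold. (a) $F_k$ is a df with $r(F_k)=r(F)$ and with pdf $f_k(x)=\frac{f(x)}{(k-1)!}(-\ln F(x))^{k-1}$ for $x\in\{y:F(y)>0\}$ (and $0$ elsewhere); and $\lim_{x\uparrow r(F)}\frac{1-F_k(x)}{(1-F(x))^k}=\frac{1}{k!}$, so that $F_k$ is tail equivalent to $H_k=1-(1-F)^k$. (b) If $F\in\mathcal{D}_l(\Phi_\alpha)$ for some $\alpha>0$, then $r(F_k)=r(F)=\infty$ and $F_k\in\mathcal{D}_l(\Phi_{k\alpha})$, with $\lim_{n\to\infty}F_k^n(a_nx+b_n)=\Phi_{k\alpha}(x)$, $x\in\mathbb{R}$, for $a_n=F^-\left(1-(k!/n)^{1/k}\right)$, $b_n=0$. (c) If $F\in\mathcal{D}_l(\Psi_\alpha)$ for some $\alpha>0$, then $r(F_k)=r(F)<\infty$ and $F_k\in\mathcal{D}_l(\Psi_{k\alpha})$, with $\lim_{n\to\infty}F_k^n(a_nx+b_n)=\Psi_{k\alpha}(x)$, $x\in\mathbb{R}$, for $a_n=r(F)-F^-\left(1-(k!/n)^{1/k}\right)$, $b_n=r(F)$. (d) If $F\in\mathcal{D}_l(\Lambda)$ and $v$ is a positive function on $(-\infty,r(F))$ with $\lim_{t\uparrow r(F)}\frac{1-F(t+v(t)x)}{1-F(t)}=e^{-x}$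 for all $x\ge 0$ (so that $\lim_{n\to\infty} F^n(v(\beta_n)x+\beta_n)=\Lambda(x)$ with $\beta_n=F^-(1-1/n)$), then $r(F_k)=r(F)$ and $F_k\in\mathcal{D}_l(\Lambda)$, with $\lim_{n\to\infty}F_k^n(a_nx+b_n)=\Lambda(x)$, $x\in\mathbb{R}$, for $b_n=F_k^-(1-1/n)$, $a_n=v(b_n)/k$.
   Context: df means distribution function on $\mathbb{R}$. For a df $F$: $r(F)=\sup\{x:F(x)<1\}$ and $F^-(y)=\inf\{x:F(x)\ge y\}$. $\Phi_\alpha(x)=\exp(-x^{-\alpha})$ for $x>0$ and $0$ for $x\le 0$; $\Psi_\alpha(x)=\exp(-|x|^{\alpha})$ for $x<0$ and $1$ for $x\ge 0$; $\Lambda(x)=\exp(-e^{-x})$. $F\in\mathcal{D}_l(G)$ means that there exist $a_n>0$, $b_n\in\mathbb{R}$ with $\lim_{n\to\infty}F^n(a_nx+b_n)=G(x)$ at all continuity points $x$ of $G$. Two dfs $A,B$ are tail equivalent if $r(A)=r(B)$ and $\lim_{x\uparrow r(A)}\frac{1-A(x)}{1-B(x)}$ exists in $(0,\infty)$. The convention $0^0=1$ is used, and formulas for norming constants are read for all $n$ large enough that they are defined and $a_n>0$. *)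

(* Defs.v *)
From mathcomp Require Import all_boot all_order all_algebra.
From mathcomp Require Import all_classical all_reals all_analysis.
Set Implicit Arguments.
Unset Strict Implicit.
Unset Printing Implicit Defensive.
Import Order.TTheory GRing.Theory Num.Theory.
Import numFieldNormedType.Exports.
Local Open Scope classical_set_scope.
Local Open Scope ring_scope.

Definition is_df (R : realType) (F : R -> R) : Prop :=
  [/\ nondecreasing F, right_continuous F,
      F x @[x --> -oo] --> (0 : R) & F x @[x --> +oo] --> (1 : R)].

Definition is_pdf (R : realType) (F f : R -> R) : Prop :=
  [/\ measurable_fun [set: R] f, forall x, 0 <= f x &
      forall x, (F x)%:E =
        (\int[lebesgue_measure]_(t in `]-oo, x]) (f t)%:E)%E].

Definition right_endpoint (R : realType) (F : R -> R) : \bar R :=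
  ereal_sup [set x%:E | x in [set x : R | F x < 1]].

(* [inf] is real-valued with default 0. For a df [F] the set below is nonempty
   and bounded below as soon as 0 < y < 1. *)
Definition quantile (R : realType) (F : R -> R) (y : R) : R :=
  inf [set x : R | y <= F x].

(* The filter of [x : R] tending to [r] from strictly below. The case [r = -oo]
   is a dummy: the right endpoint of a df is never [-oo]. *)
Definition upto (R : realType) (r : \bar R) : set_system R :=
  match r with
  | r%:E => r^'-
  | +oo%E => pinfty_nbhs R
  | -oo%E => ninfty_nbhs R
  end.

Global Instance upto_proper (R : realType) (r : \bar R) :
  ProperFilter (upto r).
Proof. by case: r => [r| |] /=; apply _. Qed.

Definition tail_equivalent (R : realType) (A B : R -> R) : Prop :=
  [/\ is_df A, is_df B, right_endpoint A = right_endpoint B &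
      exists2 c : R, 0 < c &
        (1 - A x) / (1 - B x) @[x --> upto (right_endpoint A)] --> c].

Definition in_Dl (R : realType) (F G : R -> R) : Prop :=
  exists a b : nat -> R, (forall n, 0 < a n) /\
    forall x, {for x, continuous G} ->
      F (a n * x + b n) ^+ n @[n --> \oo] --> G x.

(* Explicit norming constants: the formula for [a n] need only make sense, and
   be positive, for large [n]; convergence is asserted at every real [x]. *)
Definition cvg_under_norming (R : realType) (F G : R -> R) (a b : nat -> R) : Prop :=
  (\forall n \near \oo, 0 < a n) /\
  forall x, F (a n * x + b n) ^+ n @[n --> \oo] --> G x.

Definition frechet (R : realType) (alpha x : R) : R :=
  if 0 < x then expR (- (x `^ (- alpha))) else 0.

Definition weibull (R : realType) (alpha x : R) : R :=
  if x < 0 then expR (- (`|x| `^ alpha)) else 1.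

Definition gumbel (R : realType) (x : R) : R := expR (- expR (- x)).

Definition record_df (R : realType) (k : nat) (F : R -> R) (x : R) : R :=
  if 0 < F x then F x * \sum_(i < k) (- ln (F x)) ^+ i / i`!%:R else 0.

Definition record_pdf (R : realType) (k : nat) (F f : R -> R) (x : R) : R :=
  if 0 < F x then f x / (k.-1)`!%:R * (- ln (F x)) ^+ k.-1 else 0.

(* Main.v *)
Require Import Defs.
From mathcomp Require Import all_boot all_order all_algebra.
From mathcomp Require Import all_classical all_reals all_analysis.
From mathcomp Require Import measurable_realfun ring lra.
Set Implicit Arguments.
Unset Strict Implicit.
Unset Printing Implicit Defensive.
Import Order.TTheory GRing.Theory Num.Theory.
Import numFieldNormedType.Exports.
Local Open Scope classical_set_scope.
Local Open Scope ring_scope.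

(* F_k = h(F) for a fixed increasing function h on [0, 1] with
   h'(u) = (-ln u)^(k-1) / (k-1)!, and comparing -ln s with 1 - s gives
   (1 - u)^k / k! <= 1 - h(u) <= (1 - u)^k / (k! u^(k-1)).  So the tail of F_k is
   the k-th power of that of F up to the factor 1/k!, and everything about
   domains of attraction reduces to the tail T = 1 - F.

   From n T(a_n x + b_n) -> g(x) the explicit norming constants are recovered by
   comparing index n with index n/2: the strict monotonicity of g determines the
   limits of a_n / a_{n/2} and (b_n - b_{n/2}) / a_{n/2}, which shows that b_n
   may be replaced by 0 (Frechet) or by the right endpoint (Weibull).  Reading
   the convergence at n = floor(1 / T(t)) as t tends to the right endpoint turns
   it into the convergence of T(z(t)) / T(t) for the corresponding affine z; this
   last form passes to F_k at once. *)

(** * The function h *)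

(** Absolute continuity enters twice. It makes [F] continuous, so that [F] takes the exact value [y]
    at [quantile F y] for 0 < y < 1. It also gives the density of F_k, but [F] may fail to be
    differentiable at some points, so the chain rule for h(F) is replaced by a comparison of
    increments.

    The constant k! makes the limits come out unscaled: if n (1 - F(t_n))^k tends to k!, then n (1 -
    F_k(t_n)) tends to 1, hence the tail mass (k!/n)^(1/k). A limiting tail ratio l of F becomes l^k
    for F_k; this turns alpha into k alpha, and exp(-x) into exp(-k x), which the division of v by k
    undoes.

    Halving the index does not act alike for the two power laws. For Frechet, a_n / a_{n/2} tends to
    2^(1/alpha) > 1, and the recursion for b_n / a_n from n/2 to n is a contraction. For Weibull the
    limit is 2^(-1/alpha) < 1 and that recursion would expand; b_n is compared with the right
    endpoint along n, 2n, 4n, ... instead. For Gumbel nothing is recentred: it is enough to match v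
    with the unknown scale. *)

Section RecordTransform.
Context {R : realType}.
Implicit Types (u v w : R) (k : nat).

Local Notation h k := (record_df k (@id R)).

Lemma record_dfE k (F : R -> R) (x : R) : record_df k F x = h k (F x).
Proof. by []. Qed.

(** The derivatives telescope: the term of degree k + 1 has derivative (-ln u)^(k+1)/(k+1)! - (-ln
    u)^k/k!, whose second part cancels the derivative of the preceding sum. *)
Lemma is_derive_record_sum k u : 0 < u ->
  is_derive u 1 (fun t => t * \sum_(i < k.+1) (- ln t) ^+ i / i`!%:R)
    ((- ln u) ^+ k / k`!%:R).
Proof.
move=> u0; elim: k => [|k IH].
  rewrite (_ : (fun _ => _) = id); last first.
    by apply/funext => t; rewrite big_ord_recr big_ord0/= expr0 fact0 invr1 add0r !mulr1.
  by rewrite expr0 fact0 invr1 mulr1; exact: is_derive_id.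
have dl := is_derive1_ln u0.
pose g t : R := t * ((- ln t) ^+ k.+1 / k.+1`!%:R).
have dg : is_derive u 1 g ((- ln u) ^+ k.+1 / k.+1`!%:R - (- ln u) ^+ k / k`!%:R).
  rewrite (_ : g = id * (k.+1`!%:R^-1 \*: ((- (@ln R)) ^+ k.+1))); last first.
    apply/funext => t; rewrite /g.
    transitivity (t * (k.+1`!%:R^-1 * (((- (@ln R)) ^+ k.+1) t))) => //.
    by rewrite exprfctE mulrC [_^-1 * _]mulrC mulrC.
  apply: is_derive_eq.
  have : (k.+1%:R : R) != 0 by rewrite pnatr_eq0.
  have : (k`!%:R : R) != 0 by rewrite pnatr_eq0 -lt0n fact_gt0.
  have : u != 0 by rewrite gt_eqF.
  rewrite factS natrM /GRing.scale/= exprfctE/= [(- @ln R) u]/(- ln u).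
  set a := k.+1%:R; set b := k`!%:R; set l := ln u; move=> ? ? ?.
  rewrite exprS.
  change (u * ((a * b)^-1 * (a * (- l) ^+ k * - u^-1)) +
    (a * b)^-1 * (- l * (- l) ^+ k) * 1 = - l * (- l) ^+ k / (a * b) - (- l) ^+ k / b).
  by field; do ?[apply/andP; split].
pose s t : R := t * \sum_(i < k.+1) (- ln t) ^+ i / i`!%:R.
have -> : (fun t => t * \sum_(i < k.+2) (- ln t) ^+ i / i`!%:R) = s + g.
  by apply/funext => t; rewrite /s /g big_ord_recr/= mulrDr.
by apply: is_derive_eq; rewrite addrC subrK.
Qed.

Lemma record_idE k u : 0 < u -> h k u = u * \sum_(i < k) (- ln u) ^+ i / i`!%:R.
Proof. by rewrite /record_df /= => ->. Qed.

Lemma record_id0 k u : u <= 0 -> h k u = 0.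
Proof. by rewrite /record_df /= ltNge => ->. Qed.

Lemma record_id1 k : h k.+1 1 = 1.
Proof.
rewrite record_idE// mul1r ln1 oppr0 big_ord_recl expr0 fact0 divr1.
by rewrite big1 ?addr0// => i _; rewrite exprS !mul0r.
Qed.

Lemma is_derive_record k u : 0 < u -> is_derive u 1 (h k.+1) ((- ln u) ^+ k / k`!%:R).
Proof.
move=> u0; apply: near_eq_is_derive (is_derive_record_sum k u0).
near=> t; rewrite record_idE//; near: t; exact: lt_nbhsr.
Unshelve. all: by end_near. Qed.

(* c = 0 bounds the increments of h; c = 1 and c = w ^- k give its tail at 1. *)
Lemma record_mvt k u v (c : R) : 0 < u -> u <= v ->
  exists2 d, u <= d <= v &
    h k.+1 v + c * (1 - v) ^+ k.+1 / k.+1`!%:R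
    - (h k.+1 u + c * (1 - u) ^+ k.+1 / k.+1`!%:R) =
    ((- ln d) ^+ k / k`!%:R - c * (1 - d) ^+ k / k`!%:R) * (v - u).
Proof.
move=> u0 uv.
pose q : R -> R := cst 1 - id.
pose g : R -> R := h k.+1 + (c / k.+1`!%:R) \*: (q ^+ k.+1).
pose dg t : R := (- ln t) ^+ k / k`!%:R - c * (1 - t) ^+ k / k`!%:R.
have gE (t : R) : g t = h k.+1 t + c * (1 - t) ^+ k.+1 / k.+1`!%:R.
  rewrite /g -[LHS]/(h k.+1 t + (c / k.+1`!%:R) * (q ^+ k.+1) t).
  by rewrite exprfctE mulrAC.
have dgE (t : R) : 0 < t -> is_derive t 1 g (dg t).
  move=> t0; have := is_derive_record k t0 => dh.
  apply: is_derive_eq; rewrite /dg /GRing.scale/=; congr (_ + _).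
  have : (k.+1%:R : R) != 0 by rewrite pnatr_eq0.
  have : (k`!%:R : R) != 0 by rewrite pnatr_eq0 -lt0n fact_gt0.
  rewrite factS natrM; set a := k.+1%:R; set b := k`!%:R => ? ?.
  rewrite [q t]/(1 - t); set p := (1 - t) ^+ k.
  by rewrite sub0r; field; do ?[apply/andP; split].
have [|||d duv] := @MVT_segment R g dg u v.
- exact: uv.
- move=> t; rewrite in_itv/= => /andP[ut _]; apply: dgE; exact: lt_trans ut.
- apply: derivable_within_continuous => t; rewrite in_itv/= => /andP[ut _].
  by have [] := dgE t (lt_le_trans u0 ut).
by rewrite !gE => E; exists d.
Qed.

Lemma ln_le_subr1 u : 0 < u -> ln u <= u - 1.
Proof.
by move=> u0; rewrite -[X in ln X](subrK 1) addrC le_ln1Dx// ltrBrDr addrC subrr.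
Qed.

Lemma oppr_ln_le u w : 0 < w -> w <= u -> u <= 1 -> - ln u <= (1 - u) / w.
Proof.
move=> w0 wu u1; have u0 := lt_le_trans w0 wu.
rewrite -lnV// (le_trans (ln_le_subr1 _))// ?invr_gt0//.
rewrite (_ : u^-1 - 1 = (1 - u) / u); last first.
  by rewrite mulrBl divff ?gt_eqF// mul1r.
by rewrite ler_wpM2l ?subr_ge0// lef_pV2.
Qed.

Lemma record_increment_bounds k u v : 0 < u -> u <= v -> v <= 1 ->
  (- ln v) ^+ k / k`!%:R * (v - u) <= h k.+1 v - h k.+1 u
    <= (- ln u) ^+ k / k`!%:R * (v - u).
Proof.
move=> u0 uv v1; have [d /andP[ud dv]] := record_mvt k 0 u0 uv.
rewrite !mul0r !addr0 subr0 => ->.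
have d0 := lt_le_trans u0 ud; have v0 := lt_le_trans d0 dv.
have d1 := le_trans dv v1; have u1 := le_trans ud d1.
by apply/andP; split; rewrite ler_wpM2r ?subr_ge0// ler_wpM2r ?invr_ge0//;
  apply: lerXn2r; rewrite ?nnegrE ?oppr_ge0 ?ln_le0 ?lerN2 ?ler_ln.
Qed.

(** Case [v = 1], [c = 1] of [record_mvt]: the derivative at [d] is nonnegative because -ln d >= 1 -
    d. *)
Lemma record_tail_ge k u : 0 < u -> u <= 1 ->
  (1 - u) ^+ k.+1 / k.+1`!%:R <= 1 - h k.+1 u.
Proof.
move=> u0 u1; have [d /andP[ud d1]] := record_mvt k 1 u0 u1.
have d0 := lt_le_trans u0 ud.
rewrite record_id1 subrr expr0n/= mulr0 mul0r addr0 !mul1r => E.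
rewrite -subr_ge0 -addrA -opprD E mulr_ge0 ?subr_ge0// ler_wpM2r ?invr_ge0//.
apply: lerXn2r; rewrite ?nnegrE ?subr_ge0 ?oppr_ge0 ?ln_le0//.
by rewrite -opprB lerN2 ln_le_subr1.
Qed.

(** The derivative in [record_mvt] is now nonpositive, since -ln d <= (1 - d) / w on [w, 1]. *)
Lemma record_tail_le k u w : 0 < w -> w <= u -> u <= 1 ->
  1 - h k.+1 u <= (w ^+ k)^-1 * ((1 - u) ^+ k.+1 / k.+1`!%:R).
Proof.
move=> w0 wu u1; have u0 := lt_le_trans w0 wu.
have [d /andP[ud d1]] := record_mvt k (w ^+ k)^-1 u0 u1.
have d0 := lt_le_trans u0 ud.
rewrite record_id1 subrr expr0n/= mulr0 mul0r addr0 mulrA => E.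
rewrite -subr_le0 -addrA -opprD E mulr_le0_ge0 ?subr_ge0// subr_le0.
rewrite ler_wpM2r ?invr_ge0// mulrC -exprVn -exprMn.
apply: lerXn2r; rewrite ?nnegrE ?subr_ge0 ?oppr_ge0 ?ln_le0//.
  by rewrite divr_ge0 ?subr_ge0// ltW.
by apply: oppr_ln_le => //; exact: le_trans ud.
Qed.

Lemma record_ge0 k u : u <= 1 -> 0 <= h k u.
Proof.
move=> u1; rewrite /record_df/=; case: ifPn => // u0.
apply: mulr_ge0; [exact: ltW|apply: sumr_ge0 => i _].
by rewrite divr_ge0// exprn_ge0// oppr_ge0 ln_le0.
Qed.

Lemma record_nondecreasing k u v : u <= v -> v <= 1 -> h k.+1 u <= h k.+1 v.
Proof.
move=> uv v1; have [u0|u0] := ltP 0 u; last first.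
  by rewrite record_id0//; exact: record_ge0.
rewrite -subr_ge0; have /andP[+ _] := record_increment_bounds k u0 uv v1.
apply: le_trans; rewrite mulr_ge0 ?subr_ge0// divr_ge0// exprn_ge0//.
by rewrite oppr_ge0 ln_le0.
Qed.

Lemma record_lt1 k u : u < 1 -> h k.+1 u < 1.
Proof.
move=> u1; have [u0|u0] := ltP 0 u; last by rewrite record_id0.
rewrite -subr_gt0 (lt_le_trans _ (record_tail_ge k u0 (ltW u1)))//.
by rewrite divr_gt0 ?exprn_gt0 ?subr_gt0// ltr0n fact_gt0.
Qed.

(** Controls the logarithms at 0, for the continuity of [h] there: with y = -ln u / 2, the bound y^i
    / i! <= exp y = u^(-1/2) makes each term at most 2^i * sqrt u. *)
Lemma record_le_sqrt k u : 0 < u -> u <= 1 ->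
  h k u <= (\sum_(i < k) 2 ^+ i) * Num.sqrt u.
Proof.
move=> u0 u1; rewrite record_idE// mulr_sumr mulr_suml; apply: ler_sum => i _.
have sE : Num.sqrt u = u * expR (- ln u / 2).
  rewrite -[LHS]lnK ?posrE ?sqrtr_gt0// -powR12_sqrt ?ltW// ln_powR.
  by rewrite -{2}[u]lnK ?posrE// -expRD; congr expR; lra.
rewrite sE [leRHS]mulrCA; apply: ler_wpM2l; first exact: ltW.
have y0 : 0 <= - ln u / 2 by rewrite divr_ge0// oppr_ge0 ln_le0.
have -> : (- ln u) ^+ i = 2 ^+ i * (- ln u / 2) ^+ i.
  by rewrite -exprMn mulrCA divff// mulr1.
rewrite -mulrA; apply: ler_wpM2l; first exact: exprn_ge0.
case: (nat_of_ord i) => [|n]; first by rewrite expr0 fact0 divr1 -[leLHS]expR0 ler_expR.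
by apply: le_trans (expR_ge1Dxn n y0); rewrite lerDr ler01.
Qed.

Lemma continuous_record k : continuous (h k.+1 : R -> R).
Proof.
move=> u; have [u0|u0|<-] := ltgtP 0 u.
- apply: differentiable_continuous; apply/derivable1_diffP.
  by have [] := is_derive_record k u0.
- rewrite /continuous_at (record_id0 _ (ltW u0)).
  apply: cvg_near_cst; near=> t; rewrite record_id0//.
  by near: t; exact: lt_le_nbhsl.
- rewrite /continuous_at (record_id0 _ (lexx 0)).
  pose C : R := \sum_(i < k.+1) 2 ^+ i.
  apply: (@squeeze_cvgr _ _ _ _ (cst 0) (fun u => C * Num.sqrt u)).
  + near=> t; have t1 : t <= 1 by near: t; exact: lt_le_nbhsl.
    rewrite record_ge0//=; have [t0|t0] := ltP 0 t; first exact: record_le_sqrt.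
    rewrite record_id0// mulr_ge0 ?sqrtr_ge0//.
    by apply: sumr_ge0 => i _; rewrite exprn_ge0.
  + exact: cvg_cst.
  + have := cvgM (@cvg_cst _ C _ (nbhs (0 : R)) _) (@sqrt_continuous R 0).
    by rewrite sqrtr0 mulr0; apply; exact: nbhs_filter.
Unshelve. all: by end_near. Qed.

End RecordTransform.

(** * Limits *)

Section MonotoneTypes.
Context {R : realType} {T : Type} {F : set_system T} {FF : Filter F}.
Variables (P : T -> R -> R) (g : R -> R) (y : T -> R) (l : R).
Hypothesis P_noninc : forall i, {homo P i : x z / x <= z >-> z <= x}.
Hypothesis P_cvg : \forall z \near l, P i z @[i --> F] --> g z.

(** Monotonicity replaces uniform convergence: once [y i] lies between two fixed points close to
    [l], [P i (y i)] is trapped between the values of [P i] at these points. *)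
Lemma cvg_nonincreasing_comp : {for l, continuous g} ->
  y i @[i --> F] --> l -> P i (y i) @[i --> F] --> g l.
Proof.
move=> gc yl; apply/cvgrPdist_lt => e e0.
have e20 : 0 < e / 2 by rewrite divr_gt0.
have /nbhs_ballP[d /= d0 dB] : \forall z \near l,
    P i z @[i --> F] --> g z /\ `|g l - g z| < e / 2.
  near=> z; split; near: z => //.
  exact: (cvgr_dist_lt _ _ gc _ e20).
have d20 : 0 < d / 2 by rewrite divr_gt0.
have dd : d / 2 < d by rewrite ltr_pdivrMr// ltr_pMr// ltr1n.
have [|P1 g1] := dB (l - d / 2).
  by rewrite /ball/= opprB addrC subrK gtr0_norm.
have [|P2 g2] := dB (l + d / 2).
  by rewrite /ball/= opprD addNKr normrN gtr0_norm.
near=> i.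
have y1 : l - d / 2 < y i by near: i; apply: (cvgr_gt l) => //; rewrite ltrBlDr ltrDl.
have y2 : y i < l + d / 2 by near: i; apply: (cvgr_lt l) => //; rewrite ltrDl.
have := P_noninc i (ltW y1); have := P_noninc i (ltW y2).
have : `|g (l - d / 2) - P i (l - d / 2)| < e / 2.
  by near: i; exact: (cvgr_dist_lt _ _ P1 _ e20).
have : `|g (l + d / 2) - P i (l + d / 2)| < e / 2.
  by near: i; exact: (cvgr_dist_lt _ _ P2 _ e20).
move: g1 g2; rewrite !ltr_distl => /andP[? ?] /andP[? ?] /andP[? ?] /andP[? ?] ? ?.
by apply/andP; split; lra.
Unshelve. all: by end_near. Qed.

(** A converse of the previous lemma, with strict decrease of [g] around [l] in the role of
    continuity. It recovers arguments from values, which is how unknown norming constants become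
    known. *)
Lemma cvg_nonincreasing_inj :
  (\forall z \near l, (z < l -> g l < g z) /\ (l < z -> g z < g l)) ->
  P i (y i) @[i --> F] --> g l -> y i @[i --> F] --> l.
Proof.
move=> gd Pyl; apply/cvgrPdist_lt => e e0.
have /nbhs_ballP[d /= d0 dB] : \forall z \near l,
    P i z @[i --> F] --> g z /\ ((z < l -> g l < g z) /\ (l < z -> g z < g l)).
  by near=> z; split; near: z.
pose w := Num.min d e / 2.
have w0 : 0 < w by rewrite divr_gt0// lt_min d0.
have wd : w < d.
  by rewrite /w ltr_pdivrMr// (le_lt_trans (_ : _ <= d)) ?ge_min ?lexx// ltr_pMr// ltr1n.
have we : w < e.
  rewrite /w ltr_pdivrMr// (le_lt_trans (_ : _ <= e)) ?ge_min ?lexx ?orbT//.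
  by rewrite ltr_pMr// ltr1n.
have [|P1 [g1 _]] := dB (l - w).
  by rewrite /ball/= opprB addrC subrK gtr0_norm.
have [|P2 [_ g2]] := dB (l + w).
  by rewrite /ball/= opprD addNKr normrN gtr0_norm.
have {}g1 : g l < g (l - w) by apply: g1; rewrite ltrBlDr ltrDl.
have {}g2 : g (l + w) < g l by apply: g2; rewrite ltrDl.
(* The midpoints between [g l] and [g (l - w)], and between [g l] and [g (l + w)], separate
   [P i (y i)] from the values of [P i] at [l - w] and [l + w]. *)
near=> i.
have a1 : (g l + g (l - w)) / 2 < P i (l - w) by near: i; apply: (cvgr_gt _ P1); lra.
have a2 : P i (l + w) < (g l + g (l + w)) / 2 by near: i; apply: (cvgr_lt _ P2); lra.
have b1 : P i (y i) < (g l + g (l - w)) / 2 by near: i; apply: (cvgr_lt _ Pyl); lra.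
have b2 : (g l + g (l + w)) / 2 < P i (y i) by near: i; apply: (cvgr_gt _ Pyl); lra.
have y1 : l - w < y i.
  by rewrite ltNge; apply/negP => /(P_noninc i); rewrite leNgt (lt_trans b1).
have y2 : y i < l + w.
  by rewrite ltNge; apply/negP => /(P_noninc i); rewrite leNgt (lt_trans a2).
by rewrite ltr_distl; apply/andP; split; lra.
Unshelve. all: by end_near. Qed.

End MonotoneTypes.

(** * Powers and logarithms, halving of indices, integer parts of reciprocals *)

Section Sequences.
Context {R : realType}.
Implicit Types (u x : nat -> R).

Lemma cvg_invn : (n%:R^-1 : R) @[n --> \oo] --> (0 : R).
Proof. by rewrite -cvg_shiftS; exact: cvg_harmonic. Qed.

Lemma cvg_divn u (l : R) : n%:R * u n @[n --> \oo] --> l -> u n @[n --> \oo] --> (0 : R).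
Proof.
rewrite -cvg_shiftS -[X in _ -> X]cvg_shiftS => ul.
have : harmonic n * (n.+1%:R * u n.+1) @[n --> \oo] --> 0 * l.
  by apply: cvgM => //; exact: cvg_harmonic.
rewrite mul0r.
apply: cvg_trans; apply: near_eq_cvg.
by near=> n; rewrite /= mulrA mulVf ?mul1r// pnatr_eq0.
Unshelve. all: by end_near. Qed.

Lemma ln_bounds (u : R) : 0 < u -> 1 - u <= - ln u /\ u * - ln u <= 1 - u.
Proof.
move=> u0; split; first by rewrite -opprB lerN2 ln_le_subr1.
rewrite -lnV// mulrC -ler_pdivlMr// mulrBl mul1r divff ?gt_eqF//.
by rewrite ln_le_subr1// invr_gt0.
Qed.

(** By [ln_bounds], 1 - u lies between u * (-ln u) and -ln u, so n * (1 - u n) and -ln (u n ^+ n)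
    have the same limit when [u n] tends to 1. This and the next lemma translate between powers of a
    df and its tail. *)
Lemma cvg_expn_expR u (t : R) : n%:R * (1 - u n) @[n --> \oo] --> t ->
  u n ^+ n @[n --> \oo] --> expR (- t).
Proof.
move=> ut; have u1 : u n @[n --> \oo] --> (1 : R).
  have : 1 - (1 - u n) @[n --> \oo] --> (1 - 0 : R).
    by apply: cvgB; [exact: cvg_cst|exact: cvg_divn ut].
  by rewrite subr0; under eq_cvg do rewrite opprB addrC subrK.
have u0 : \forall n \near \oo, 0 < u n by apply: (cvgr_gt _ u1).
have lt : n%:R * - ln (u n) @[n --> \oo] --> t.
  apply: (@squeeze_cvgr _ _ _ _ (fun n => n%:R * (1 - u n))
     (fun n => n%:R * (1 - u n) * (u n)^-1)) => //; last first.
    by rewrite -[t]mulr1 -[X in _ * X]invr1; apply: cvgM => //; apply: cvgV.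
  near=> n; have un0 : 0 < u n by near: n.
  have [l1 l2] := ln_bounds un0.
  by rewrite -mulrA !ler_wpM2l//= ler_pdivlMr// mulrC.
have : expR (- (n%:R * - ln (u n))) @[n --> \oo] --> expR (- t).
  by apply: continuous_cvg; [exact: continuous_expR|exact: cvgN].
apply: cvg_trans; apply: near_eq_cvg; near=> n.
have un0 : 0 < u n by near: n.
by rewrite /= mulrN opprK expRM_natl lnK.
Unshelve. all: by end_near. Qed.

Lemma expn_expR_cvg u (t : R) : (forall n, 0 <= u n) ->
  u n ^+ n @[n --> \oo] --> expR (- t) ->
  n%:R * (1 - u n) @[n --> \oo] --> t.
Proof.
move=> un_ge0 ut.
have u0 : \forall n \near \oo, 0 < u n.
  have : \forall n \near \oo, 0 < u n ^+ n by apply: (cvgr_gt _ ut); exact: expR_gt0.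
  move=> H; near=> n; rewrite lt_neqAle un_ge0 andbT; apply/eqP => E.
  have : 0 < u n ^+ n by near: n.
  (* At n = 0 the power is 1 even if [u n] vanishes, hence the restriction to positive n. *)
  by rewrite -E expr0n gtn_eqF ?ltxx//; near: n; exact: nbhs_infty_gt.
have lt : n%:R * - ln (u n) @[n --> \oo] --> t.
  have : - ln (u n ^+ n) @[n --> \oo] --> - ln (expR (- t)).
    by apply: cvgN; apply: continuous_cvg => //; exact/continuous_ln/expR_gt0.
  rewrite expRK opprK; apply: cvg_trans; apply: near_eq_cvg; near=> n.
  by rewrite /= lnXn ?mulrN ?mulr_natl//; near: n.
have u1 : u n @[n --> \oo] --> (1 : R).
  have : expR (- (- ln (u n))) @[n --> \oo] --> expR (- 0 : R).
    by apply: continuous_cvg; [exact: continuous_expR|apply: cvgN; exact: cvg_divn lt].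
  rewrite oppr0 expR0.
  apply: cvg_trans; apply: near_eq_cvg; near=> n.
  by rewrite /= opprK lnK// posrE; near: n.
apply: (@squeeze_cvgr _ _ _ _ (fun n => n%:R * - ln (u n) * u n)
     (fun n => n%:R * - ln (u n))) => //; last first.
  by rewrite -[t]mulr1; apply: cvgM.
near=> n; have un0 : 0 < u n by near: n.
have [l1 l2] := ln_bounds un0.
by rewrite -mulrA !ler_wpM2l//= mulrC.
Unshelve. all: by end_near. Qed.

Lemma cvg_half : n./2 @[n --> \oo] --> \oo.
Proof.
apply/cvgnyPge => N; near=> n.
rewrite -[N](doubleK) half_leq//; near: n; exact: nbhs_infty_ge.
Unshelve. all: by end_near. Qed.

Lemma cvg_half_ratio : n./2%:R / n%:R @[n --> \oo] --> (2^-1 : R).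
Proof.
have h0 := cvg_invn.
apply: (@squeeze_cvgr _ _ _ _ (fun n => 2^-1 - 2^-1 * n%:R^-1) (fun=> 2^-1)).
- near=> n; have n0 : 0 < n%:R :> R by rewrite ltr0n; near: n; exact: nbhs_infty_gt.
  have nE : n%:R = (odd n)%:R + 2 * n./2%:R :> R.
    by rewrite -{1}(odd_double_half n) natrD -muln2 natrM mulrC.
  have o0 : (0 : R) <= (odd n)%:R by [].
  have o1 : (odd n)%:R <= 1 :> R by case: odd.
  by rewrite ler_pdivlMr// ler_pdivrMr// mulrBl mulfVK ?gt_eqF//; apply/andP; split; lra.
- rewrite -[X in _ --> X]subr0 -[X in _ --> _ - X](mulr0 2^-1).
  by apply: cvgB; [exact: cvg_cst|apply: cvgM => //; exact: cvg_cst].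
- exact: cvg_cst.
Unshelve. all: by end_near. Qed.

(** A contraction along n, n/2, n/4, ...: strong induction gives a global bound, and each further
    halving multiplies its excess over [d] by [q]. *)
Lemma cvg_half_recursion x (q : R) : (forall n, 0 <= x n) -> 0 <= q < 1 ->
  (forall e, 0 < e -> \forall n \near \oo, x n <= q * x n./2 + e) ->
  x n @[n --> \oo] --> (0 : R).
Proof.
move=> x0 /andP[q0 q1] xq; apply/cvgrPdist_lt => e e0.
have q10 : 0 < 1 - q by rewrite subr_gt0.
(* [e'] makes [d] the fixed point of the recursion: q * d + e' = d. *)
pose d := e / 2; pose e' := d * (1 - q).
have d0 : 0 < d by rewrite divr_gt0.
have e'0 : 0 < e' by rewrite mulr_gt0.
have [N _ NP] := xq _ e'0.
pose C := \sum_(i < N.+1) x i.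
have xC i : (i <= N)%N -> x i <= C.
  move=> iN; rewrite /C (bigD1 (Ordinal (iN : i < N.+1)%N))//= lerDl.
  by apply: sumr_ge0.
have C0 : 0 <= C by apply: sumr_ge0.
have xall n : x n <= C + d.
  elim/ltn_ind: n => n IH; have [nN|Nn] := leqP n N.
    by rewrite (le_trans (xC _ nN))// lerDl ltW.
  have n0 : (0 < n)%N by exact: leq_ltn_trans Nn.
  have hn : (n./2 < n)%N by rewrite ltn_half_double -addnn -{1}[n]addn0 ltn_add2l.
  have := NP n (ltnW Nn).
  have := IH _ hn => h1 h2.
  have := ler_wpM2l q0 h1; rewrite /e' in h2; have : q * C <= C by rewrite ler_piMl// ltW.
  by move: h2; lra.
have xj j : \forall n \near \oo, x n <= q ^+ j * C + d.
  elim: j => [|j [M _ MP]]; first by apply: nearW => n; rewrite mul1r.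
  near=> n.
  have nN : (N <= n)%N by near: n; exact: nbhs_infty_ge.
  have nM : (M <= n./2)%N.
    by rewrite -[M]doubleK half_leq//; near: n; exact: nbhs_infty_ge.
  have := NP n nN; have := ler_wpM2l q0 (MP _ nM).
  by rewrite exprS /e' => h1 h2; move: h1 h2; lra.
have [j jP] : exists j, q ^+ j * C < d.
  have : q ^+ j * C @[j --> \oo] --> (0 : R).
    rewrite -[X in _ --> X](mul0r C); apply: cvgM; last exact: cvg_cst.
    by apply: cvg_expr; rewrite ger0_norm.
  by move=> /(cvgr_lt _)/(_ _ d0)[j _ /(_ j (leqnn j))]; exists j.
near=> n; have : x n <= q ^+ j * C + d by near: n; exact: xj.
by rewrite sub0r normrN ger0_norm//; move: jP; rewrite /d; lra.
Unshelve. all: by end_near. Qed.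

(** Lets limits along the integers be read along any vanishing tail mass: the integer part N of 1/t
    satisfies 1 - t < N t <= 1. *)
Lemma cvg_truncn_inv (T : Type) (F : set_system T) (FF : Filter F) (t : T -> R) :
  (\forall i \near F, 0 < t i) -> t i @[i --> F] --> (0 : R) ->
  (Num.truncn (t i)^-1 @[i --> F] --> \oo) /\
  (Num.truncn (t i)^-1)%:R * t i @[i --> F] --> (1 : R).
Proof.
move=> t0 tc; split.
  apply/cvgnyPge => N; near=> i.
  have ti0 : 0 < t i by near: i.
  have tN : t i < N.+1%:R^-1 by near: i; apply: (cvgr_lt _ tc); rewrite invr_gt0.
  move: tN; rewrite -[ltRHS]div1r ltr_pdivlMr// -natr1 => tN.
  rewrite truncn_ge_nat ?invr_ge0 ?(ltW ti0)// -[leRHS]mul1r ler_pdivlMr//.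
  by move: tN ti0; lra.
apply: (@squeeze_cvgr _ _ _ _ (fun i => 1 - t i) (fun=> 1)).
- near=> i; have ti0 : 0 < t i by near: i.
  have /truncn_itv/andP[] : 0 <= (t i)^-1 by rewrite invr_ge0 ltW.
  rewrite -[leRHS]mul1r -[ltLHS]mul1r ler_pdivlMr// ltr_pdivrMr// => h1.
  rewrite -natr1 mulrDl mul1r => h2.
  by apply/andP; split; lra.
- rewrite -[X in _ --> X]subr0; apply: cvgB => //; exact: cvg_cst.
- exact: cvg_cst.
Unshelve. all: by end_near. Qed.

End Sequences.

(** * Distribution functions and quantiles *)

Section DistributionFunctions.
Context {R : realType}.
Variables (F : R -> R).
Hypothesis hF : is_df F.

Lemma df_nondecreasing : {homo F : x y / x <= y}.
Proof. by case: hF. Qed.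

Lemma df_ge0 x : 0 <= F x.
Proof.
case: hF => _ _ F0 _; rewrite leNgt; apply/negP => Fx.
have [M [_ MP]] : \forall z \near -oo, F x < F z by apply: (cvgr_gt _ F0).
have := MP (Num.min M x - 1).
rewrite ltrBlDr (le_lt_trans (_ : _ <= M)) ?ge_min ?lexx ?ltrDl//.
move=> /(_ isT); rewrite ltNge => /negP; apply; apply: df_nondecreasing.
by rewrite lerBlDr (le_trans (_ : _ <= x)) ?ge_min ?lexx ?orbT// lerDl.
Qed.

Lemma df_le1 x : F x <= 1.
Proof.
case: hF => _ _ _ F1; rewrite leNgt; apply/negP => Fx.
have [M [_ MP]] : \forall z \near +oo, F z < F x by apply: (cvgr_lt _ F1).
have := MP (Num.max M x + 1).
rewrite (@le_lt_trans _ _ (Num.max M x)) ?le_max ?lexx ?ltrDl//.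
move=> /(_ isT); rewrite ltNge => /negP; apply; apply: df_nondecreasing.
by rewrite (@le_trans _ _ (Num.max M x)) ?le_max ?lexx ?orbT// lerDl.
Qed.

Hypothesis cF : continuous F.

Lemma lt_right_endpoint x : (x%:E < right_endpoint F)%E = (F x < 1).
Proof.
apply/idP/idP => [/ereal_sup_gt[_ /= [y Fy <-]]|Fx].
  by rewrite lte_fin => /ltW/df_nondecreasing/le_lt_trans; apply.
have /nbhs_ballP[d /= d0 dB] : \forall y \near x, F y < 1.
  exact: (cvgr_lt (F x) (@cF x) _ Fx).
have d20 : 0 < d / 2 by rewrite divr_gt0.
apply: (@lt_le_trans _ _ (x + d / 2)%:E); first by rewrite lte_fin ltrDl.
apply: ereal_sup_ubound; exists (x + d / 2) => //; apply: dB.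
by rewrite /ball/= opprD addNKr normrN gtr0_norm// ltr_pdivrMr// ltr_pMr// ltr1n.
Qed.

Lemma right_endpoint_gtNy : (-oo < right_endpoint F)%E.
Proof.
case: hF => _ _ F0 _; have /cvgr_lt : F x @[x --> -oo] --> (0 : R) := F0.
move=> /(_ 1 ltr01)[M [_ MP]].
apply: lt_trans (ltNyr (M - 1)) _; rewrite lt_right_endpoint; apply: MP.
by rewrite ltrBlDr ltrDl.
Qed.

(** Since [F (t n)] tends to 1, [t n] eventually exceeds every x with [F x < 1], and such x come
    arbitrarily close to the right endpoint. *)
Lemma cvg_upto (T : Type) (G : set_system T) (FG : Filter G) (t : T -> R) :
  (\forall n \near G, F (t n) < 1) -> F (t n) @[n --> G] --> (1 : R) ->
  t n @[n --> G] --> upto (right_endpoint F).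
Proof.
move=> t1 tc.
have key x : F x < 1 -> \forall n \near G, x < t n.
  move=> Fx; near=> n; have : F x < F (t n) by near: n; exact: (cvgr_gt _ tc).
  by rewrite ltNge [in X in _ -> X]ltNge; apply: contra; exact: df_nondecreasing.
have := right_endpoint_gtNy; have := lt_right_endpoint.
case: (right_endpoint F) => [r| |] //= rE _.
- have tr : \forall n \near G, t n < r.
    by near=> n; rewrite -lte_fin rE; near: n.
  move=> A [e /= e0 eA]; have := key (r - e).
  rewrite -rE lte_fin ltrBlDr ltrDl => /(_ e0) tre.
  apply: (filterS _ (filterI tr tre)) => n [h2 h1]; apply: eA => //.
  by rewrite /ball/= gtr0_norm ?subr_gt0//; lra.
- by apply/cvgryPgt => A; apply: key; rewrite -rE ltry.
Unshelve. all: by end_near. Qed.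

Lemma upto_lt1 : \forall t \near upto (right_endpoint F), F t < 1.
Proof.
have := right_endpoint_gtNy; have := lt_right_endpoint.
case: (right_endpoint F) => [r| |] //= rE _.
- by near=> t; rewrite -rE lte_fin; near: t; exact: nbhs_left_lt.
- by apply: nearW => t; rewrite -rE ltry.
Unshelve. all: by end_near. Qed.

Lemma cvg_upto_df : F t @[t --> upto (right_endpoint F)] --> (1 : R).
Proof.
have := right_endpoint_gtNy; have := lt_right_endpoint.
case: (right_endpoint F) => [r| |] //= rE _; last by case: hF.
have <- : F r = 1.
  by apply/eqP; rewrite eq_le df_le1 leNgt -rE ltxx.
exact: cvg_at_left_filter (@cF r).
Qed.

Lemma quantileK y : 0 < y -> y < 1 -> F (quantile F y) = y.
Proof.
case: hF => _ _ F0 F1 y0 y1; set S := [set x | y <= F x]; set q := quantile F y.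
have [M [_ MP]] : \forall x \near -oo, F x < y by apply: (cvgr_lt _ F0).
have [N [_ NP]] : \forall x \near +oo, y < F x by apply: (cvgr_gt _ F1).
have Slb : lbound S M.
  by move=> x /= Sx; rewrite leNgt; apply/negP => /MP; rewrite ltNge Sx.
have Sinf : has_inf S.
  split; last by exists M.
  by exists (N + 1) => /=; apply/ltW/NP; rewrite ltrDl.
apply/eqP; rewrite eq_le; apply/andP; split; rewrite leNgt; apply/negP => Fq.
- have /nbhs_ballP[d /= d0 dB] : \forall x \near q, y < F x.
    exact: (cvgr_gt (F q) (@cF q) _ Fq).
  have d20 : 0 < d / 2 by rewrite divr_gt0.
  have : q <= q - d / 2.
    apply: ge_inf; first by exists M.
    apply/ltW/dB; rewrite /ball/= opprB addrC subrK gtr0_norm//.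
    by rewrite ltr_pdivrMr// ltr_pMr// ltr1n.
  by rewrite leNgt ltrBlDr ltrDl d20.
- have /nbhs_ballP[d /= d0 dB] : \forall x \near q, F x < y.
    exact: (cvgr_lt (F q) (@cF q) _ Fq).
  have d20 : 0 < d / 2 by rewrite divr_gt0.
  have : q + d / 2 <= q.
    apply: lb_le_inf; first by case: Sinf.
    move=> x /= Sx; rewrite leNgt; apply/negP => /ltW/df_nondecreasing.
    move=> /(le_trans Sx); rewrite leNgt dB//.
    by rewrite /ball/= opprD addNKr normrN gtr0_norm// ltr_pdivrMr// ltr_pMr// ltr1n.
  by rewrite leNgt ltrDl d20.
Qed.

End DistributionFunctions.

(** * The density of F_k *)

Section RecordDensity.
Context {R : realType}.
Local Notation leb := (@lebesgue_measure R).
Local Notation h k := (record_df k (@id R)).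

Lemma ge0_integral_itv_split (g : R -> \bar R) (a : itv_bound R) (x y : R) :
  measurable_fun [set: R] g -> (forall t, 0 <= g t)%E ->
  (a <= BRight x)%O -> x <= y ->
  (\int[leb]_(t in [set` Interval a (BRight y)]) g t =
   \int[leb]_(t in [set` Interval a (BRight x)]) g t + \int[leb]_(t in `]x, y]) g t)%E.
Proof.
move=> mg g0 ax xy.
rewrite (@itv_bndbnd_setU _ _ _ (BRight x))//.
rewrite ge0_integral_setU//.
- exact: measurable_funTS.
- apply/disj_setPS => t [/=]; rewrite 2!in_itv/= => /andP[_ tx] /andP[].
  by rewrite ltNge tx.
Qed.

Variables (F f : R -> R).
Hypotheses (hF : is_df F) (hf : is_pdf F f).

Let mf : measurable_fun [set: R] (EFin \o f).
Proof. by case: hf => mf _ _; exact/measurable_EFinP. Qed.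

Let f0 t : (0 <= (f t)%:E)%E.
Proof. by case: hf => _ f0 _; rewrite lee_fin. Qed.

Let FE x : (F x)%:E = (\int[leb]_(t in `]-oo, x]) (f t)%:E)%E.
Proof. by case: hf. Qed.

(** Only left continuity is missing from [is_df]. By monotone convergence, the integrals up to x -
    1/(n+1) tend to the integral over the open half-line, which differs from the closed one by a
    null set. *)
Lemma pdf_continuous : continuous F.
Proof.
have ndF := df_nondecreasing hF.
move=> x; apply/left_right_continuousP; split; last by case: hF => _ rc _ _; exact: rc.
pose A n : set R := `]-oo, x - n.+1%:R^-1]%classic.
have hn n : 0 < (n.+1%:R^-1 : R) by rewrite invr_gt0.
have cA : (F (x - n.+1%:R^-1))%:E @[n --> \oo] --> (F x)%:E.
  have -> : (F x)%:E = (\int[leb]_(t in \bigcup_n A n) (f t)%:E)%E.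
    rewrite FE -integral_itv_bndo_bndc; last exact: measurable_funTS.
    congr integral; apply/seteqP; split => [t /=|t [n _]] /=; rewrite !in_itv/=.
      move=> tx. near \oo => n. exists n => //; rewrite /A /= in_itv/= lerBrDl -lerBrDr.
      apply/ltW; near: n; apply: (cvgr_lt _ (@cvg_harmonic R)); by rewrite subr_gt0.
    by rewrite /A/= in_itv/= => /le_lt_trans; apply; rewrite ltrBlDr ltrDl.
  under eq_cvg do rewrite FE.
  apply: ge0_nondecreasing_set_cvg_integral => //.
  - move=> n m nm; rewrite subsetEset /A => t /=; rewrite !in_itv/= => /le_trans; apply.
    by rewrite lerD2l lerN2 lef_pV2 ?posrE// ler_nat.
  - by move=> n; exact: measurable_itv.
  - by move=> n; exact: measurable_funTS.
have {}cA : F (x - n.+1%:R^-1) @[n --> \oo] --> F x by move/fine_cvgP : cA => [_].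
apply/cvgrPdist_lt => e e0.
have [n _ nP] : \forall n \near \oo, F x - e < F (x - n.+1%:R^-1).
  by apply: (cvgr_gt _ cA); rewrite ltrBlDr ltrDl.
near=> t.
have tx : t <= x by near: t; exact: nbhs_left_le.
have nt : x - n.+1%:R^-1 <= t by near: t; apply: nbhs_left_ge; rewrite ltrBlDr ltrDl.
have := nP n (leqnn n); have := ndF _ _ tx; have := ndF _ _ nt => a1 a2 /= a3.
by rewrite ger0_norm ?subr_ge0//; lra.
Unshelve. all: by end_near. Qed.

Lemma pdf_integral_itv x y : x <= y ->
  (\int[leb]_(t in `]x, y]) (f t)%:E = (F y - F x)%:E)%E.
Proof.
move=> xy; have := ge0_integral_itv_split mf f0 (isT : (-oo <= BRight x)%O) xy.
by rewrite -!FE EFinB => ->; rewrite addeAC subee// add0e.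
Qed.

Variable k : nat.
Let fk := record_pdf k.+1 F f.
Let phi u : R := (- ln u) ^+ k / k`!%:R.

Lemma measurable_record_pdf : measurable_fun [set: R] fk.
Proof.
have mF := continuous_measurable_fun pdf_continuous.
apply: measurable_fun_ifT => //; first exact: measurable_fun_ltr.
apply: measurable_funM.
  by apply: measurable_funM => //; exact/measurable_EFinP.
apply: measurable_funX; apply: measurable_funN.
exact: measurableT_comp (@measurable_ln R) mF.
Qed.

Lemma record_pdf_ge0 t : 0 <= fk t.
Proof.
rewrite /fk /record_pdf; case: ifP => // Ft; rewrite mulr_ge0//.
  by rewrite divr_ge0// -lee_fin.
by rewrite exprn_ge0// oppr_ge0 ln_le0// df_le1.
Qed.

Let mfk : measurable_fun [set: R] (EFin \o fk).
Proof. by apply/measurable_EFinP; exact: measurable_record_pdf. Qed.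

Let fk0 t : (0 <= (fk t)%:E)%E.
Proof. by rewrite lee_fin record_pdf_ge0. Qed.

Let phi_ge0 u : u <= 1 -> 0 <= phi u.
Proof. by move=> u1; rewrite divr_ge0// exprn_ge0// oppr_ge0 ln_le0. Qed.

Let phi_noninc u v : 0 < u -> u <= v -> v <= 1 -> phi v <= phi u.
Proof.
move=> u0 uv v1; rewrite ler_wpM2r ?invr_ge0//.
have u1 := le_trans uv v1; have v0 := lt_le_trans u0 uv.
by apply: lerXn2r; rewrite ?nnegrE ?oppr_ge0 ?ln_le0 ?lerN2 ?ler_ln ?posrE.
Qed.

(** On ]x, y] the density is [phi (F t) * f t], where [phi (F t)] lies between [phi (F y)] and
    [phi (F x)] and [f] has mass [F y - F x]. *)
Let integral_phi_bounds x y : 0 < F x -> x <= y ->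
  ((phi (F y) * (F y - F x))%:E <= \int[leb]_(t in `]x, y]) (fk t)%:E
    <= (phi (F x) * (F y - F x))%:E)%E.
Proof.
move=> Fx xy; have ndF := df_nondecreasing hF.
have fkE t : x < t -> fk t = phi (F t) * f t.
  move=> xt; rewrite /fk /record_pdf (lt_le_trans Fx (ndF _ _ (ltW xt))) /phi/=.
  by rewrite mulrC mulrA mulrAC.
have bE c : 0 <= c -> ((c * (F y - F x))%:E = \int[leb]_(t in `]x, y]) (c%:E * (f t)%:E))%E.
  move=> c0; rewrite ge0_integralZl_EFin//; last exact: measurable_funTS.
  by rewrite pdf_integral_itv.
rewrite !bE ?phi_ge0 ?df_le1//; apply/andP; split; apply: ge0_le_integral => //.
all: try by move=> t _; rewrite ?mule_ge0// ?lee_fin phi_ge0 ?df_le1.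
all: try exact: measurable_funTS.
all: try by apply: measurable_funTS; apply: measurable_funeM.
all: move=> t /=; rewrite in_itv/= => /andP[xt ty]; rewrite -EFinM lee_fin fkE//.
all: apply: ler_wpM2r; first by rewrite -lee_fin.
- by rewrite phi_noninc ?df_le1 ?ndF// (lt_le_trans Fx) ?ndF// ltW.
- by rewrite phi_noninc ?df_le1 ?ndF// ltW.
Qed.

(* Cutting ]x, y] into n pieces of equal F-mass makes the errors telescope. *)
Let integral_record_pdf_itv x y : 0 < F x -> x <= y ->
  (\int[leb]_(t in `]x, y]) (fk t)%:E = (h k.+1 (F y) - h k.+1 (F x))%:E)%E.
Proof.
move=> Fx xy; have ndF := df_nondecreasing hF.
pose I a b := fine (\int[leb]_(t in `]a, b]) (fk t)%:E)%E.
have IE a b : x <= a -> a <= b -> (I a b)%:E = (\int[leb]_(t in `]a, b]) (fk t)%:E)%E.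
  move=> xa ab; rewrite fineK// ge0_fin_numE ?integral_ge0//.
  have /andP[_ /le_lt_trans->//] := integral_phi_bounds (lt_le_trans Fx (ndF _ _ xa)) ab.
  exact: ltry.
(* The defect of the identity to be proved; it is additive over adjacent intervals. *)
pose D a b := I a b - (h k.+1 (F b) - h k.+1 (F a)).
have Dadd a b c : x <= a -> a <= b -> b <= c -> D a c = D a b + D b c.
  move=> xa ab bc; have ac := le_trans ab bc; have xb := le_trans xa ab.
  suff : I a c = I a b + I b c by rewrite /D => ->; lra.
  apply: EFin_inj; rewrite EFinD !IE//.
  by apply: ge0_integral_itv_split => //; rewrite bnd_simp.
(* The integral and the increment of [h] lie in the same interval, from [phi (F b) * (F b - F a)] to
   [phi (F a) * (F b - F a)]. *)
have Dbound a b : x <= a -> a <= b -> `|D a b| <= (F b - F a) * (phi (F a) - phi (F b)).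
  move=> xa ab; have Fa := lt_le_trans Fx (ndF _ _ xa).
  have := integral_phi_bounds Fa ab; rewrite -IE// !lee_fin => /andP[i1 i2].
  have /andP[] := record_increment_bounds k Fa (ndF _ _ ab) (df_le1 hF _).
  rewrite -/(phi (F a)) -/(phi (F b)) => i3 i4.
  by rewrite ler_norml /D; apply/andP; split; lra.
suff D0 : D x y = 0 by rewrite -IE//; congr EFin; move: D0; rewrite /D; lra.
pose B := (F y - F x) * (phi (F x) - phi (F y)).
have B0 : 0 <= B by apply: le_trans (Dbound x y (lexx x) xy).
suff Dn n : `|D x y| <= n.+1%:R^-1 * B.
  apply/eqP; rewrite -normr_le0.
  have c0 : (n.+1%:R^-1 * B) @[n --> \oo] --> (0 : R).
    by rewrite -(mul0r B); apply: cvgM; [exact: cvg_harmonic|exact: cvg_cst].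
  rewrite -(cvg_lim _ c0)//; apply: limr_ge; first by apply/cvg_ex; exists 0.
  exact: nearW.
pose d := n.+1%:R^-1 * (F y - F x).
have d0 : 0 <= d by rewrite mulr_ge0 ?invr_ge0// subr_ge0 ndF.
have part m : (m <= n.+1)%N -> exists t, [/\ x <= t, t <= y, F t = F x + m%:R * d &
    `|D x t| <= d * (phi (F x) - phi (F t))].
  elim: m => [_|m IH mn].
    exists x; split => //; first by rewrite mul0r addr0.
    by apply: le_trans (Dbound x x _ _) _; rewrite // !subrr mul0r mulr0.
  have [t [xt ty Ft Dt]] := IH (ltnW mn).
  have [||s] := @IVT R F t y (F x + m.+1%:R * d) ty.
  - by apply: continuous_subspaceT => ?; exact: pdf_continuous.
  - have Fty := ndF _ _ ty.
    rewrite (min_idPl Fty) (max_idPr Fty) Ft lerD2l ler_wpM2r ?ler_nat//=.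
    rewrite -lerBrDl /d mulrA ler_piMl ?subr_ge0 ?ndF//.
    by rewrite ler_pdivrMr// mul1r ler_nat.
  rewrite in_itv/= => /andP[ts sy] Fs; have xs := le_trans xt ts.
  exists s; split => //; rewrite (Dadd x t s)//.
  apply: le_trans (ler_normD _ _) _; have := Dbound t s xt ts.
  rewrite {1}Fs {1}Ft -natr1 (_ : _ - _ = d); last by lra.
  by move: Dt; lra.
have [t [xt ty Ft Dt]] := part n.+1 (leqnn _).
have {}Ft : F t = F y by rewrite Ft /d mulrA divff ?mul1r ?pnatr_eq0//; lra.
(* The last cutting point may lie left of [y] if [F] is flat there, but the remaining piece has no
   mass, hence no defect. *)
rewrite (Dadd x t y)//; apply: le_trans (ler_normD _ _) _.
have := Dbound t y xt ty; rewrite Ft subrr mul0r => Dty.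
move: Dt; rewrite Ft /B mulrA -/d => Dt; lra.
Qed.

(** The formula over ]a, x] requires [F a > 0], as [phi] may blow up at 0. It is applied from points
    [a n] where [F] takes the value F x / (n + 1); the intervals ]a n, x] exhaust the part of ]-oo,
    x] where [fk] can be nonzero, and [h] is continuous at 0. *)
Lemma record_pdfP : is_pdf (record_df k.+1 F) fk.
Proof.
have ndF := df_nondecreasing hF.
split; [exact: measurable_record_pdf|exact: record_pdf_ge0|move=> x].
have [Fx|Fx] := ltP 0 (F x); last first.
  rewrite record_dfE record_id0// integral0_eq// => t /=; rewrite in_itv/= => tx.
  by rewrite /fk /record_pdf ltNge (le_trans (ndF _ _ tx) Fx).
have level n : exists2 t, t <= x & F t = n.+1%:R^-1 * F x.
  have l0 : 0 < n.+1%:R^-1 * F x by rewrite mulr_gt0 ?invr_gt0.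
  have l1 : n.+1%:R^-1 * F x <= F x by rewrite ler_piMl ?(ltW Fx)// invf_le1// ler1n.
  have [_ _ F0 _] := hF.
  have [M [_ MP]] : \forall z \near -oo, F z < n.+1%:R^-1 * F x by apply: (cvgr_lt _ F0).
  pose z := Num.min x (M - 1).
  have zx : z <= x by rewrite ge_min lexx.
  have Fz : F z < n.+1%:R^-1 * F x.
    by apply: MP; rewrite (@le_lt_trans _ _ (M - 1)) ?ge_min ?lexx ?orbT// ltrBlDr ltrDl.
  have [||t] := @IVT R F z x (n.+1%:R^-1 * F x) zx.
  - by apply: continuous_subspaceT => ?; exact: pdf_continuous.
  - by rewrite (min_idPl (ndF _ _ zx)) (max_idPr (ndF _ _ zx)) (ltW Fz).
  by rewrite in_itv/= => /andP[_ tx] Ft; exists t.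
have [a ax Fa] : exists2 a : nat -> R, (forall n, a n <= x) &
    forall n, F (a n) = n.+1%:R^-1 * F x.
  have /choice[a aP] : forall n, exists t, t <= x /\ F t = n.+1%:R^-1 * F x.
    by move=> n; have [t] := level n; exists t.
  by exists a => n; have [] := aP n.
have Fa0 n : 0 < F (a n) by rewrite Fa mulr_gt0 ?invr_gt0.
have F_lt s t : F s < F t -> s < t.
  by rewrite !ltNge; apply: contra; exact: ndF.
have cFa : F (a n) @[n --> \oo] --> (0 : R).
  under eq_cvg do rewrite Fa.
  have : harmonic n * F x @[n --> \oo] --> 0 * F x.
    by apply: cvgM; [exact: cvg_harmonic|exact: cvg_cst].
  by rewrite mul0r.
have -> : (\int[leb]_(t in `]-oo, x]) (fk t)%:E =
    \int[leb]_(t in \bigcup_n `]a n, x]%classic) (fk t)%:E)%E.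
  rewrite [LHS]integral_mkcond [RHS]integral_mkcond; congr integral.
  apply/funext => t; rewrite !patchE.
  case: ifPn => [/set_mem/=|/negP tx]; last first.
    rewrite ifF//; apply/negP => /set_mem[n _ /=]; rewrite in_itv/= => /andP[_ tn].
    by apply: tx; apply: mem_set; rewrite /= in_itv/=.
  rewrite in_itv/= => tx; case: ifPn => // /negP tn.
  rewrite /fk /record_pdf ifF//; apply/negP => Ft; apply: tn; apply: mem_set.
  have [n _ nP] : \forall n \near \oo, F (a n) < F t by apply: (cvgr_lt _ cFa).
  by exists n => //=; rewrite in_itv/= tx F_lt// nP/=.
apply: cvg_unique (ge0_nondecreasing_set_cvg_integral _ _ _ _) => //=.
- have : (h k.+1 (F x) - h k.+1 (F (a n)))%:E @[n --> \oo] --> (h k.+1 (F x))%:E.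
    apply: cvg_EFin; first exact: nearW.
    rewrite -[X in _ --> X]subr0 -(record_id0 k.+1 (lexx (0 : R))).
    apply: cvgB; first exact: cvg_cst.
    by apply: continuous_cvg => //; exact: continuous_record.
  apply: cvg_trans; apply: near_eq_cvg; apply: nearW => n.
  by rewrite integral_record_pdf_itv.
- move=> n m nm; rewrite subsetEset => t /=; rewrite !in_itv/= => /andP[ant ->].
  rewrite andbT (le_lt_trans _ ant)//; move: nm; rewrite leq_eqVlt => /predU1P[->//|nm].
  by apply/ltW/F_lt; rewrite !Fa ltr_pM2r// ltf_pV2 ?posrE// ltr_nat.
- by move=> n; exact: measurable_funTS.
Qed.

End RecordDensity.

(** * Convergence of tails *)

Section Tails.
Context {R : realType}.
Variables (F : R -> R).
Hypotheses (hF : is_df F) (cF : continuous F).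
Local Notation r := (right_endpoint F).

Let tail_noninc (c a b : R) : 0 <= c -> 0 < a ->
  {homo (fun x => c * (1 - F (a * x + b))) : x z / x <= z >-> z <= x}.
Proof.
move=> c0 a0 x z xz; rewrite ler_wpM2l// lerB//.
by apply: df_nondecreasing => //; rewrite lerD2r ler_wpM2l// ltW.
Qed.

(** * Strictly decreasing tail limits under arbitrary norming *)

Section Types.
Variables (a b : nat -> R) (g : R -> R) (U : set R).
Hypotheses (a_gt0 : forall n, 0 < a n) (oU : open U).
Hypothesis tail_cvg : forall x, U x ->
  n%:R * (1 - F (a n * x + b n)) @[n --> \oo] --> g x.
Hypothesis g_dec : forall x y, U x -> U y -> x < y -> g y < g x.

Let g_dec_near x : U x ->
  \forall z \near x, (z < x -> g x < g z) /\ (x < z -> g z < g x).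
Proof.
move=> Ux; have := open_nbhs_nbhs (conj oU Ux); apply: filterS => z Uz.
by split; exact: g_dec.
Qed.

(* At index n, the points a n * x + b n have tail mass g x / n, hence g x / 2 = g (c x)
   in units of the index n./2. *)
Lemma tail_doubling (c x1 x2 : R) : x1 != x2 -> U x1 -> U x2 ->
  (forall x, U x -> U (c * x) /\ g (c * x) = g x / 2) ->
  a n / a n./2 @[n --> \oo] --> c /\ (b n - b n./2) / a n./2 @[n --> \oo] --> (0 : R).
Proof.
move=> x12 Ux1 Ux2 gc.
have yc x : U x -> (a n * x + b n - b n./2) / a n./2 @[n --> \oo] --> c * x.
  move=> Ux; have [Ucx gcx] := gc x Ux.
  apply: (@cvg_nonincreasing_inj _ _ _ _
    (fun n z => n./2%:R * (1 - F (a n./2 * z + b n./2))) g).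
  - by move=> n; exact: tail_noninc.
  - have := open_nbhs_nbhs (conj oU Ucx); apply: filterS => z Uz.
    exact: cvg_comp cvg_half (tail_cvg Uz).
  - exact: g_dec_near.
  - rewrite gcx mulrC.
    have : n./2%:R / n%:R * (n%:R * (1 - F (a n * x + b n))) @[n --> \oo] --> 2^-1 * g x.
      by apply: cvgM; [exact: cvg_half_ratio|exact: tail_cvg].
    apply: cvg_trans; apply: near_eq_cvg; near=> n => /=.
    have n0 : n%:R != 0 :> R.
      by rewrite pnatr_eq0 -lt0n; near: n; exact: nbhs_infty_gt.
    rewrite [LHS]mulrA divfK//; congr (_ * (1 - F _)).
    by rewrite mulrCA divff ?gt_eqF// mulr1 subrK.
(* The affine map from scale n to scale [n./2] converges at two distinct points to the values of x
   |-> c * x, so its slope and its intercept converge. *)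
have x120 : x1 - x2 != 0 by rewrite subr_eq0.
have ac : a n / a n./2 @[n --> \oo] --> c.
  have : ((a n * x1 + b n - b n./2) / a n./2 - (a n * x2 + b n - b n./2) / a n./2)
      * (x1 - x2)^-1 @[n --> \oo] --> (c * x1 - c * x2) * (x1 - x2)^-1.
    by apply: cvgM; [apply: cvgB; exact: yc|exact: cvg_cst].
  rewrite -mulrBr mulfK//; apply: cvg_trans; apply: near_eq_cvg; near=> n => /=.
  have : a n./2 != 0 by rewrite gt_eqF.
  by move=> h; field; rewrite x120 h.
split=> //.
have : (a n * x1 + b n - b n./2) / a n./2 - a n / a n./2 * x1 @[n --> \oo]
    --> c * x1 - c * x1.
  by apply: cvgB; [exact: yc|apply: cvgM => //; exact: cvg_cst].
rewrite subrr; apply: cvg_trans; apply: near_eq_cvg; near=> n => /=.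
have : a n./2 != 0 by rewrite gt_eqF.
by move=> h; field.
Unshelve. all: by end_near. Qed.

(** The index [N i] is kept apart from the parameter [i]: with [N = id] the lemma recentres the
    sequence, with [N = tail_index F] it passes to a real parameter tending to the right
    endpoint. *)
Lemma tail_comp (T : Type) (G : set_system T) (FG : Filter G) (N : T -> nat)
    (y : T -> R) (x : R) :
  N i @[i --> G] --> \oo -> U x -> {for x, continuous g} -> y i @[i --> G] --> x ->
  (N i)%:R * (1 - F (a (N i) * y i + b (N i))) @[i --> G] --> g x.
Proof.
move=> Noo Ux gx yx.
apply: (@cvg_nonincreasing_comp _ _ _ _
  (fun i z => (N i)%:R * (1 - F (a (N i) * z + b (N i)))) g) yx => //.
- by move=> i; exact: tail_noninc.
- have := open_nbhs_nbhs (conj oU Ux); apply: filterS => z Uz.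
  exact: cvg_comp Noo (tail_cvg Uz).
Qed.

Lemma tail_inj (T : Type) (G : set_system T) (FG : Filter G) (N : T -> nat)
    (z : T -> R) (x : R) :
  N i @[i --> G] --> \oo -> U x ->
  (N i)%:R * (1 - F (z i)) @[i --> G] --> g x ->
  (z i - b (N i)) / a (N i) @[i --> G] --> x.
Proof.
move=> Noo Ux zx.
apply: (@cvg_nonincreasing_inj _ _ _ _
  (fun i z => (N i)%:R * (1 - F (a (N i) * z + b (N i)))) g).
- by move=> i; exact: tail_noninc.
- have := open_nbhs_nbhs (conj oU Ux); apply: filterS => y Uy.
  exact: cvg_comp Noo (tail_cvg Uy).
- exact: g_dec_near.
- move: zx; apply: cvg_trans; apply: near_eq_cvg; near=> i => /=.
  by rewrite mulrCA divff ?gt_eqF// mulr1 subrK.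
Unshelve. all: by end_near. Qed.

End Types.

Definition tail_index (t : R) : nat := Num.truncn (1 - F t)^-1.

Lemma cvg_tail_upto : 1 - F t @[t --> upto r] --> (0 : R).
Proof.
rewrite -[X in _ --> X](subrr 1); apply: cvgB; first exact: cvg_cst.
exact: cvg_upto_df.
Qed.

Lemma near_tail_gt0 : \forall t \near upto r, 0 < 1 - F t.
Proof. by have := upto_lt1 hF cF; apply: filterS => t; rewrite subr_gt0. Qed.

Lemma cvg_tail_index : tail_index t @[t --> upto r] --> \oo.
Proof. by have [] := cvg_truncn_inv _ near_tail_gt0 cvg_tail_upto. Qed.

Lemma cvg_tail_index_mul : (tail_index t)%:R * (1 - F t) @[t --> upto r] --> (1 : R).
Proof. by have [] := cvg_truncn_inv _ near_tail_gt0 cvg_tail_upto. Qed.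

Lemma cvg_tail_ratio (z : R -> R) (l : R) :
  (tail_index t)%:R * (1 - F (z t)) @[t --> upto r] --> l <->
  (1 - F (z t)) / (1 - F t) @[t --> upto r] --> l.
Proof.
have Nt := cvg_tail_index_mul.
split => zl.
- have : (tail_index t)%:R * (1 - F (z t)) * ((tail_index t)%:R * (1 - F t))^-1
      @[t --> upto r] --> l * 1^-1.
    by apply: cvgM => //; apply: cvgV => //; exact: oner_neq0.
  rewrite invr1 mulr1; apply: cvg_trans; apply: near_eq_cvg; near=> t => /=.
  have N0 : (tail_index t)%:R != 0 :> R.
    rewrite pnatr_eq0 -lt0n; near: t.
    by move/cvgnyPgt : cvg_tail_index; exact.
  by rewrite invfM mulrACA divff// mul1r.
- have : (tail_index t)%:R * (1 - F t) * ((1 - F (z t)) / (1 - F t))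
      @[t --> upto r] --> 1 * l by exact: cvgM.
  rewrite mul1r; apply: cvg_trans; apply: near_eq_cvg; near=> t => /=.
  have T0 : 1 - F t != 0 by rewrite gt_eqF//; near: t; exact: near_tail_gt0.
  by rewrite -mulrA [X in _ * X]mulrC divfK.
Unshelve. all: by end_near. Qed.

End Tails.

(** * Norming F_k *)

Section Norming.
Context {R : realType}.
Local Notation h k := (record_df k (@id R)).

Lemma cvg_record_tail (k : nat) (u : nat -> R) (l : R) :
  (forall n, u n <= 1) -> u n @[n --> \oo] --> (1 : R) ->
  n%:R * (1 - u n) ^+ k.+1 @[n --> \oo] --> k.+1`!%:R * l ->
  n%:R * (1 - h k.+1 (u n)) @[n --> \oo] --> l.
Proof.
move=> u_le1 u1 ul.
have f0 : k.+1`!%:R != 0 :> R by rewrite pnatr_eq0 -lt0n fact_gt0.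
have u0 : \forall n \near \oo, 0 < u n by apply: (cvgr_gt _ u1).
have low : n%:R * ((1 - u n) ^+ k.+1 / k.+1`!%:R) @[n --> \oo] --> l.
  have : n%:R * (1 - u n) ^+ k.+1 / k.+1`!%:R @[n --> \oo] --> k.+1`!%:R * l / k.+1`!%:R.
    by apply: cvgM => //; exact: cvg_cst.
  by rewrite mulrAC divff// mul1r; under eq_cvg do rewrite -mulrA.
apply: (@squeeze_cvgr _ _ _ _ (fun n => n%:R * ((1 - u n) ^+ k.+1 / k.+1`!%:R))
  (fun n => (u n ^+ k)^-1 * (n%:R * ((1 - u n) ^+ k.+1 / k.+1`!%:R)))) => //.
- near=> n; have un0 : 0 < u n by near: n.
  rewrite [X in _ && (_ <= X)]mulrCA !ler_wpM2l//= ?record_tail_ge//.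
  exact: record_tail_le.
- rewrite -[X in _ --> X]mul1r; apply: cvgM => //.
  rewrite -[X in _ --> X]invr1; apply: cvgV => //.
  by have := cvg_comp _ _ u1 (@exprn_continuous R k 1); rewrite expr1n.
Unshelve. all: by end_near. Qed.

Lemma cvg_under_norming_in_Dl (K G : R -> R) (a b : nat -> R) :
  cvg_under_norming K G a b -> in_Dl K G.
Proof.
(* [in_Dl] asks for positive scales at every index; the finitely many others are replaced by 1. *)
move=> [a0 KG]; exists (fun n => if 0 < a n then a n else 1), b; split.
  by move=> n; case: ifP.
move=> x _; apply: cvg_trans (KG x); apply: near_eq_cvg.
by near=> n; rewrite ifT//; near: n.
Unshelve. all: by end_near. Qed.

Variables (F : R -> R).
Hypotheses (hF : is_df F) (cF : continuous F).
Local Notation r := (right_endpoint F).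

Lemma cvg_quantile_upto (p : nat -> R) :
  (\forall n \near \oo, 0 < p n < 1) -> p n @[n --> \oo] --> (0 : R) ->
  (\forall n \near \oo, F (quantile F (1 - p n)) = 1 - p n) /\
  quantile F (1 - p n) @[n --> \oo] --> upto r.
Proof.
move=> p01 p0.
have Fq : \forall n \near \oo, F (quantile F (1 - p n)) = 1 - p n.
  near=> n; have /andP[pn0 pn1] : 0 < p n < 1 by near: n.
  by rewrite quantileK//; lra.
split => //; apply: cvg_upto => //.
- near=> n; have /andP[pn0 pn1] : 0 < p n < 1 by near: n.
  have -> : F (quantile F (1 - p n)) = 1 - p n by near: n.
  by lra.
- have : 1 - p n @[n --> \oo] --> (1 - 0 : R) by apply: cvgB; [exact: cvg_cst|].
  rewrite subr0; apply: cvg_trans; apply: near_eq_cvg; near=> n.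
  by apply/esym; near: n.
Unshelve. all: by end_near. Qed.

Lemma cvg_tail_scaled (t : nat -> R) (z : R -> R) (l s : R) (k : nat) :
  (1 - F (z y)) / (1 - F y) @[y --> upto r] --> l -> t n @[n --> \oo] --> upto r ->
  n%:R * (1 - F (t n)) ^+ k @[n --> \oo] --> s ->
  n%:R * (1 - F (z (t n))) ^+ k @[n --> \oo] --> s * l ^+ k.
Proof.
move=> zl tr ts.
have zlt : (1 - F (z (t n))) / (1 - F (t n)) @[n --> \oo] --> l by exact: cvg_comp tr zl.
have : n%:R * (1 - F (t n)) ^+ k * ((1 - F (z (t n))) / (1 - F (t n))) ^+ k
    @[n --> \oo] --> s * l ^+ k.
  by apply: cvgM => //; exact: cvg_comp zlt (@exprn_continuous R k l).
apply: cvg_trans; apply: near_eq_cvg; near=> n.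
have T0 : 1 - F (t n) != 0.
  rewrite gt_eqF//; near: n; exact: tr _ (near_tail_gt0 hF cF).
by rewrite -mulrA -exprMn mulrCA divff// mulr1.
Unshelve. all: by end_near. Qed.

(** Common to the three types, with [z] affine in its argument for fixed x. The limit k! at [t n]
    cancels the factor 1/k! in the tail of F_k and leaves the power of [l]. *)
Lemma record_norming (k : nat) (t : nat -> R) (z : R -> R) (l : R) :
  (1 - F (z y)) / (1 - F y) @[y --> upto r] --> l -> t n @[n --> \oo] --> upto r ->
  n%:R * (1 - F (t n)) ^+ k.+1 @[n --> \oo] --> (k.+1`!%:R : R) ->
  record_df k.+1 F (z (t n)) ^+ n @[n --> \oo] --> expR (- (l ^+ k.+1)).
Proof.
move=> zl tr tk; apply: cvg_expn_expR; apply: cvg_record_tail.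
- by move=> n; exact: df_le1.
- have Tz : 1 - F (z (t n)) @[n --> \oo] --> (0 : R).
    have : (1 - F (z (t n))) / (1 - F (t n)) * (1 - F (t n)) @[n --> \oo] --> l * 0.
      apply: cvgM; first exact: cvg_comp tr zl.
      exact: cvg_comp tr (cvg_tail_upto hF cF).
    rewrite mulr0; apply: cvg_trans; apply: near_eq_cvg; near=> n.
    rewrite divfK// gt_eqF//; near: n; exact: tr _ (near_tail_gt0 hF cF).
  have : 1 - (1 - F (z (t n))) @[n --> \oo] --> (1 - 0 : R).
    by apply: cvgB; [exact: cvg_cst|].
  by rewrite subr0; under eq_cvg do rewrite opprB addrC subrK.
- exact: cvg_tail_scaled.
Unshelve. all: by end_near. Qed.

Lemma norming (t : nat -> R) (z : R -> R) (l : R) :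
  (1 - F (z y)) / (1 - F y) @[y --> upto r] --> l -> t n @[n --> \oo] --> upto r ->
  n%:R * (1 - F (t n)) @[n --> \oo] --> (1 : R) ->
  F (z (t n)) ^+ n @[n --> \oo] --> expR (- l).
Proof.
move=> zl tr tk; apply: cvg_expn_expR.
have := @cvg_tail_scaled t z l 1 1 zl tr; rewrite mul1r.
exact.
Qed.

End Norming.

(** * Domains of attraction of F *)

Section PowerFunctions.
Context {R : realType}.

Lemma continuous_powR (p x : R) : 0 < x -> {for x, continuous (fun y => y `^ p)}.
Proof.
move=> x0; apply: differentiable_continuous; apply/derivable1_diffP.
by have [] := is_derive1_powR p x0.
Qed.

Lemma powR_half (alpha x : R) : 0 < alpha -> 0 <= x ->
  ((2^-1 `^ alpha^-1) * x) `^ alpha = x `^ alpha / 2.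
Proof.
move=> a0 x0; rewrite powRM ?powR_ge0// -powRrM mulVf ?gt_eqF// powRr1 ?invr_ge0//.
by rewrite mulrC.
Qed.

Lemma powRXn (x p : R) (k : nat) : (x `^ p) ^+ k = x `^ (k%:R * p).
Proof. by rewrite -powR_mulrn ?powR_ge0// -powRrM mulrC. Qed.

Lemma powR_invnK (x : R) (k : nat) : 0 <= x -> (x `^ k.+1%:R^-1) ^+ k.+1 = x.
Proof.
by move=> x0; rewrite powRXn divff ?pnatr_eq0// powRr1.
Qed.

Lemma continuous_near_eq (f g : R -> R) (x : R) :
  {near x, f =1 g} -> {for x, continuous f} -> {for x, continuous g}.
Proof.
move=> fg fc; have fgx : f x = g x := nbhs_singleton fg.
change (g y @[y --> x] --> g x); rewrite -fgx.
by apply: cvg_trans fc; apply: near_eq_cvg.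
Qed.

Lemma continuous_frechet (alpha x : R) : 0 < x -> {for x, continuous (frechet alpha)}.
Proof.
move=> x0; apply: (@continuous_near_eq (fun y => expR (- y `^ (- alpha)))).
  by near=> y; rewrite /frechet ifT//; near: y; exact: lt_nbhsr.
apply: continuous_cvg; first exact: continuous_expR.
by apply: cvgN; exact: continuous_powR.
Unshelve. all: by end_near. Qed.

Lemma continuous_normr_powR (p x : R) : x < 0 -> {for x, continuous (fun y => `|y| `^ p)}.
Proof.
move=> x0; have nx : 0 < `|x| by rewrite normr_gt0 lt_eqF.
exact: cvg_comp (@norm_continuous _ R x) (continuous_powR nx).
Qed.

Lemma continuous_weibull (alpha x : R) : x < 0 -> {for x, continuous (weibull alpha)}.
Proof.
move=> x0; apply: (@continuous_near_eq (fun y => expR (- `|y| `^ alpha))).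
  by near=> y; rewrite /weibull ifT//; near: y; exact: lt_nbhsl.
apply: continuous_cvg; first exact: continuous_expR.
by apply: cvgN; exact: continuous_normr_powR.
Unshelve. all: by end_near. Qed.

Lemma continuous_expRN : continuous (fun x : R => expR (- x)).
Proof.
move=> x; apply: continuous_cvg; first exact: continuous_expR.
by apply: cvgN.
Qed.

Lemma continuous_gumbel : continuous (@gumbel R).
Proof.
move=> x; apply: continuous_cvg; first exact: continuous_expR.
by apply: cvgN; exact: continuous_expRN.
Qed.

End PowerFunctions.

Section DomainsOfAttraction.
Context {R : realType}.
Variables (F : R -> R).
Hypotheses (hF : is_df F) (cF : continuous F).
Local Notation r := (right_endpoint F).
Local Notation N := (tail_index F).

Let fr : Filter (upto r). Proof. exact: filter_filter. Qed.

(** * Frechet type: centring at 0 *)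

Section Frechet.
Variables (alpha : R) (alpha0 : 0 < alpha) (hD : in_Dl F (frechet alpha)).
Let g (x : R) := x `^ (- alpha).
Let U : set R := [set x | 0 < x].

Let oU : open U. Proof. exact: open_gt. Qed.

Let g_dec x y : U x -> U y -> x < y -> g y < g x.
Proof.
move=> /= x0 y0 xy; rewrite /g !powRN ltf_pV2 ?posrE ?powR_gt0//.
by rewrite gt0_ltr_powR ?nnegrE ?ltW.
Qed.

Let g_cont x : U x -> {for x, continuous g}.
Proof. exact: continuous_powR. Qed.

Let centered : exists2 a : nat -> R, (forall n, 0 < a n) &
  forall x, U x -> n%:R * (1 - F (a n * x)) @[n --> \oo] --> g x.
Proof.
have [a [b [a0 ab]]] := hD.
have tl x : U x -> n%:R * (1 - F (a n * x + b n)) @[n --> \oo] --> g x.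
  move=> x0; apply: expn_expR_cvg; first by move=> n; exact: df_ge0.
  have := ab x (continuous_frechet x0); rewrite /frechet ifT//; exact.
exists a => // x Ux.
(* The solution of c^(-alpha) = 1/2. *)
pose c : R := 2 `^ alpha^-1.
have c1 : 1 < c.
  have p1 : (1 : R) `^ alpha^-1 = 1 by rewrite powR1.
  rewrite -[ltLHS]p1; apply: gt0_ltr_powR; rewrite ?nnegrE ?invr_gt0//.
  by rewrite ltr1n.
have c0 : 0 < c by apply: lt_trans c1.
have [||||ac bc] := @tail_doubling _ _ hF a b g U a0 oU tl g_dec c 1 2.
- by rewrite lt_eqF// ltr1n.
- exact: ltr01.
- exact: ltr0n.
- move=> y /= y0; split; first by rewrite /U/= mulr_gt0.
  rewrite /g powRM ?(ltW y0) ?(ltW c0)// /c -powRrM mulrN mulVf ?gt_eqF//.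
  by rewrite powR_inv1// mulrC.
have d0 : `|b n / a n| @[n --> \oo] --> (0 : R).
  have ci : c^-1 < 1 by rewrite invf_lt1.
  (* Any number strictly between 1/c and 1 would do: [a n./2 / a n] tends to 1/c and is eventually
     below [q]. *)
  pose q := (1 + c^-1) / 2.
  have ci0 : 0 < c^-1 by rewrite invr_gt0.
  have q1 : q < 1 by rewrite /q; lra.
  have q0 : 0 < q by rewrite /q; lra.
  apply: (@cvg_half_recursion _ _ q) => [n||e e0]; first exact: normr_ge0.
    by rewrite ltW.
  have ac' : a n./2 / a n @[n --> \oo] --> c^-1.
    have : (a n / a n./2)^-1 @[n --> \oo] --> c^-1.
      by apply: cvgV => //; exact: lt0r_neq0.
    by under eq_cvg do rewrite invf_div.
  near=> n.
  have en : `|(b n - b n./2) / a n./2| < e by near: n; exact: cvgr0_norm_lt.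
  have rn : a n./2 / a n < q by near: n; apply: (cvgr_lt _ ac'); rewrite /q; lra.
  have r0 : 0 < a n./2 / a n by rewrite divr_gt0.
  (* The recursion for b / a: the second summand vanishes in the limit and the outer factor
     contracts. *)
  have -> : b n / a n = (b n./2 / a n./2 + (b n - b n./2) / a n./2) * (a n./2 / a n).
    have : a n != 0 by rewrite gt_eqF.
    have : a n./2 != 0 by rewrite gt_eqF.
    by move=> h1 h2; field; rewrite h1 h2.
  rewrite normrM [`|a n./2 / a n|]gtr0_norm//.
  apply: le_trans (_ : (`|b n./2 / a n./2| + e) * (a n./2 / a n) <= _).
    by rewrite ler_wpM2r ?(ltW r0)// (le_trans (ler_normD _ _))// lerD2l ltW.
  rewrite mulrDl; apply: lerD.
    by rewrite mulrC ler_wpM2r// ltW.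
  by rewrite ler_piMr ?(ltW e0)// ltW// (lt_trans rn).
have := @tail_comp _ _ hF a b g U a0 oU tl _ \oo eventually_filter
  id (fun n => x - b n / a n) x _ Ux (g_cont Ux).
have yx : x - b n / a n @[n --> \oo] --> x.
  rewrite -[X in _ --> X]subr0; apply: cvgB; first exact: cvg_cst.
  by apply: norm_cvg0.
move=> /(_ cvg_id yx); apply: cvg_trans; apply: near_eq_cvg; near=> n => /=.
by congr (_ * (1 - F _)); rewrite mulrBr mulrCA divff ?gt_eqF// mulr1 subrK.
Unshelve. all: by end_near. Qed.

(** If [F] reached 1 at some y > 0, the scales [a m] would stay below y for large m. Then a m * (a n
    / y) <= a n, and the tail at the left-hand side vanishes as m grows, so [F (a n)] would be 1 for
    a large n, against the positive limit of the rescaled tail. *)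
Lemma frechet_endpoint : r = +oo%E.
Proof.
have [a a0 tl] := centered.
have T0 x : 0 < x -> 1 - F (a n * x) @[n --> \oo] --> (0 : R).
  by move=> x0; exact: cvg_divn (tl _ x0).
have Fx1 x : F x < 1.
  rewrite ltNge; apply/negP => Fx.
  pose y := Num.max x 1.
  have y0 : 0 < y by rewrite lt_max ltr01 orbT.
  have Fy : 1 <= F y by rewrite (le_trans Fx)// df_nondecreasing// le_max lexx.
  have [n _ nP] : \forall n \near \oo, 0 < n%:R * (1 - F (a n * 1)).
    by apply: (cvgr_gt _ (tl 1 ltr01)); exact: powR_gt0.
  have Fa m : (n <= m)%N -> F (a m) < 1.
    move=> nm; have := nP m nm; rewrite mulr1 => /= h.
    rewrite -subr_gt0 ltNge; apply/negP => h2.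
    by have := mulr_ge0_le0 (ler0n R m) h2; rewrite leNgt h.
  have ay m : (n <= m)%N -> a m < y.
    move=> nm; rewrite ltNge; apply/negP => /(df_nondecreasing hF).
    by move=> /(le_trans Fy); rewrite leNgt Fa.
  have : 1 - F (a n) <= 0.
    have := T0 _ (divr_gt0 (a0 n) y0) => cT.
    rewrite -(cvg_lim _ cT)//; apply: limr_ge; first by apply/cvg_ex; exists 0.
    exists n => // m nm /=; rewrite lerD2l lerN2 df_nondecreasing//.
    by rewrite mulrCA ler_piMr ?ltW// ltr_pdivrMr// mul1r ay.
  by rewrite leNgt subr_gt0 Fa.
have := lt_right_endpoint hF cF; have := right_endpoint_gtNy hF cF.
by case: r => [s| |] // _ /(_ s); rewrite ltxx Fx1.
Qed.

(** Since [g 1 = 1] and [N t] times the tail at [t] tends to 1, [tail_inj] shows that [t] is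
    asymptotic to [a (N t)] and can replace it as the scale. *)
Lemma frechet_tail_ratio x : 0 < x ->
  (1 - F (t * x)) / (1 - F t) @[t --> upto r] --> x `^ (- alpha).
Proof.
move=> x0; have [a a0 tl] := centered.
have tl0 y : U y -> n%:R * (1 - F (a n * y + 0)) @[n --> \oo] --> g y.
  by move=> Uy; under eq_cvg do rewrite addr0; exact: tl.
have Noo := cvg_tail_index hF cF.
have ta : t / a (N t) @[t --> upto r] --> (1 : R).
  have := @tail_inj _ _ hF a (fun=> 0) g U a0 oU tl0 g_dec _ (upto r) fr N id 1 Noo ltr01.
  rewrite /g powR1 => /(_ (cvg_tail_index_mul hF cF)).
  by under eq_cvg do rewrite subr0.
apply/(cvg_tail_ratio hF cF (fun t => t * x)).
have := @tail_comp _ _ hF a (fun=> 0) g U a0 oU tl0 _ (upto r) fr N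
  (fun t => t / a (N t) * x) x Noo x0 (g_cont x0).
have yx : t / a (N t) * x @[t --> upto r] --> x.
  by rewrite -[X in _ --> X]mul1r; apply: cvgM => //; exact: cvg_cst.
move=> /(_ yx); apply: cvg_trans; apply: near_eq_cvg; near=> t => /=.
by rewrite addr0 mulrA mulrCA divff ?gt_eqF// mulr1.
Unshelve. all: by end_near. Qed.

End Frechet.

(** * Weibull type: centring at the right endpoint *)

Section Weibull.
Variables (alpha : R) (alpha0 : 0 < alpha) (hD : in_Dl F (weibull alpha)).
Let g (x : R) := `|x| `^ alpha.
Let U : set R := [set x | x < 0].

Let oU : open U. Proof. exact: open_lt. Qed.

Let g_dec x y : U x -> U y -> x < y -> g y < g x.
Proof.
move=> /= x0 y0 xy; rewrite /g gt0_ltr_powR ?nnegrE//.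
by rewrite !ltr0_norm// ltrN2.
Qed.

Let g_cont x : U x -> {for x, continuous g}.
Proof. exact: continuous_normr_powR. Qed.

(** [fine] sends an infinite endpoint to 0, so finiteness is proved together with the recentring.
    Both follow from trapping [r] between [b n - e * a n] and [b n + e * a n] for every e > 0. *)
Let centered : (r < +oo)%E /\ exists2 a : nat -> R, (forall n, 0 < a n) &
  forall x, U x -> n%:R * (1 - F (a n * x + fine r)) @[n --> \oo] --> g x.
Proof.
have [a [b [a0 ab]]] := hD.
have tl x : U x -> n%:R * (1 - F (a n * x + b n)) @[n --> \oo] --> g x.
  move=> x0; apply: expn_expR_cvg; first by move=> n; exact: df_ge0.
  have := ab x (continuous_weibull x0); rewrite /weibull ifT//; exact.
pose c : R := 2^-1 `^ alpha^-1.
have c0 : 0 < c by rewrite powR_gt0 ?invr_gt0.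
have c1 : c < 1.
  have p1 : (1 : R) `^ alpha^-1 = 1 by rewrite powR1.
  rewrite -[ltRHS]p1; apply: gt0_ltr_powR; rewrite ?nnegrE ?invr_gt0//.
  by rewrite invf_lt1// ltr1n.
have U1 : U (-1) by rewrite /U/= oppr_lt0.
have [||||ac bc] := @tail_doubling _ _ hF a b g U a0 oU tl g_dec c (-1) (-2).
- by rewrite eqr_opp lt_eqF// ltr1n.
- by [].
- by rewrite /U/= oppr_lt0.
- move=> y /= y0; split; first by rewrite /U/= pmulr_rlt0.
  by rewrite /g normrM gtr0_norm// powR_half.
(* b n + e * a n does not increase along n, 2n, 4n, ..., while the tail there vanishes. *)
have upper e : 0 < e -> \forall n \near \oo, (r <= (b n + e * a n)%:E)%E.
  move=> e0.
  have [M _ MP] : \forall n \near \oo, b n + e * a n <= b n./2 + e * a n./2.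
    have rc : (b n - b n./2) / a n./2 + e * (a n / a n./2) @[n --> \oo] --> 0 + e * c.
      by apply: cvgD => //; apply: cvgM => //; exact: cvg_cst.
    near=> n.
    have : (b n - b n./2) / a n./2 + e * (a n / a n./2) < e.
      by near: n; apply: (cvgr_lt _ rc); rewrite add0r gtr_pMr.
    by rewrite mulrA -mulrDl ltr_pdivrMr// => h; lra.
  near=> n.
  have nM : (M < n)%N by near: n; exact: nbhs_infty_gt.
  have mono j : b (n * 2 ^ j)%N + e * a (n * 2 ^ j)%N <= b n + e * a n.
    elim: j => [|j IH]; first by rewrite muln1.
    apply: le_trans IH; have := MP (n * 2 ^ j.+1)%N.
    rewrite (_ : (n * 2 ^ j.+1)./2 = n * 2 ^ j)%N; last first.
      by rewrite expnS mulnCA mul2n doubleK.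
    by apply; rewrite /= (leq_trans (ltnW nM))// leq_pmulr// expn_gt0.
  rewrite leNgt lt_right_endpoint// -leNgt -subr_le0.
  have joo : (n * 2 ^ j)%N @[j --> \oo] --> \oo.
    apply/cvgnyPge => A; near=> j.
    apply: (@leq_trans (2 ^ j)); last by rewrite leq_pmull// (leq_ltn_trans _ nM).
    apply: (@leq_trans j); first by near: j; exact: nbhs_infty_ge.
    by rewrite ltnW// ltn_expl.
  have cT : 1 - F (a (n * 2 ^ j)%N * -1 + b (n * 2 ^ j)%N) @[j --> \oo] --> (0 : R).
    exact: cvg_comp joo (cvg_divn (tl _ U1)).
  rewrite -(cvg_lim _ cT)//; apply: limr_ge; first by apply/cvg_ex; exists 0.
  near=> j; rewrite lerD2l lerN2 df_nondecreasing//.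
  apply: le_trans (mono j); rewrite mulrN1 addrC lerD2l.
  by rewrite (@le_trans _ _ 0) ?oppr_le0 ?mulr_ge0 ?ltW.
(* The limit [g (- e)] is positive, so the tail at this point is eventually nonzero. *)
have lower e : 0 < e -> \forall n \near \oo, ((b n - e * a n)%:E < r)%E.
  move=> e0; have Ue : U (- e) by rewrite /U/= oppr_lt0.
  have ge0 : 0 < g (- e) by rewrite powR_gt0// normrN gtr0_norm.
  near=> n; rewrite lt_right_endpoint// -subr_gt0.
  have : 0 < n%:R * (1 - F (a n * - e + b n)) by near: n; exact: (cvgr_gt _ (tl _ Ue)).
  rewrite mulrN [- _ + b n]addrC [a n * e]mulrC => h; rewrite ltNge; apply/negP => h2.
  by have := mulr_ge0_le0 (ler0n R n) h2; rewrite leNgt h.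
have rfin : (r < +oo)%E.
  have [n _ /(_ n (leqnn n)) /= rn] := upper 1 ltr01.
  exact: le_lt_trans rn (ltry _).
split => //; exists a => // x Ux.
have rE : r = (fine r)%:E.
  by rewrite fineK// fin_numElt rfin (right_endpoint_gtNy hF cF).
have rb : (fine r - b n) / a n @[n --> \oo] --> (0 : R).
  apply/cvgrPdist_le => e e0; near=> n.
  have : (r <= (b n + e * a n)%:E)%E by near: n; exact: upper.
  have : ((b n - e * a n)%:E < r)%E by near: n; exact: lower.
  rewrite {1 2}rE lte_fin lee_fin => h1 h2.
  rewrite sub0r normrN ler_norml ler_pdivlMr// ler_pdivrMr// mulNr.
  by apply/andP; split; lra.
have := @tail_comp _ _ hF a b g U a0 oU tl _ \oo eventually_filter
  id (fun n => x + (fine r - b n) / a n) x _ Ux (g_cont Ux).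
have yx : x + (fine r - b n) / a n @[n --> \oo] --> x.
  by rewrite -[X in _ --> X]addr0; apply: cvgD => //; exact: cvg_cst.
move=> /(_ cvg_id yx); apply: cvg_trans; apply: near_eq_cvg; near=> n => /=.
congr (_ * (1 - F _)); rewrite mulrDr [a n * (_ / _)]mulrCA divff ?gt_eqF// mulr1.
by rewrite -addrA subrK.
Unshelve. all: by end_near. Qed.

Lemma weibull_endpoint : (r < +oo)%E.
Proof. by have [] := centered. Qed.

(** The tail limit equals 1 at -1, so [fine r - t] is asymptotic to [a (N t)]. *)
Lemma weibull_tail_ratio x : x < 0 ->
  (1 - F ((fine r - t) * x + fine r)) / (1 - F t) @[t --> upto r] --> `|x| `^ alpha.
Proof.
move=> x0; have [_ [a a0 tl]] := centered.
have Noo := cvg_tail_index hF cF.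
have U1 : U (-1) by rewrite /U/= oppr_lt0.
have ta : (t - fine r) / a (N t) @[t --> upto r] --> (-1 : R).
  have := @tail_inj _ _ hF a (fun=> fine r) g U a0 oU tl g_dec
    _ (upto r) fr N id (-1) Noo U1.
  by rewrite /g normrN normr1 powR1 => /(_ (cvg_tail_index_mul hF cF)).
apply/(cvg_tail_ratio hF cF (fun t => (fine r - t) * x + fine r)).
have := @tail_comp _ _ hF a (fun=> fine r) g U a0 oU tl _ (upto r) fr N
  (fun t => - ((t - fine r) / a (N t)) * x) x Noo x0 (g_cont x0).
have yx : - ((t - fine r) / a (N t)) * x @[t --> upto r] --> x.
  rewrite -[X in _ --> X]mul1r -[X in X * _]opprK.
  by apply: cvgM; [exact: cvgN|exact: cvg_cst].
move=> /(_ yx); apply: cvg_trans; apply: near_eq_cvg; near=> t => /=.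
congr (_ * (1 - F (_ + _))); rewrite -mulNr opprB mulrA mulrCA divff ?gt_eqF// mulr1.
by [].
Unshelve. all: by end_near. Qed.

End Weibull.

(** * Gumbel type: matching the given scale function *)

Section Gumbel.
Variables (hD : in_Dl F (@gumbel R)) (v : R -> R).
Hypothesis v_ratio : forall x, 0 <= x ->
  (1 - F (t + v t * x)) / (1 - F t) @[t --> upto r] --> expR (- x).
Let g (x : R) := expR (- x).

Let g_dec x y : [set: R] x -> [set: R] y -> x < y -> g y < g x.
Proof. by move=> _ _ xy; rewrite /g ltr_expR ltrN2. Qed.

(** Extends [v_ratio] to negative x. Its instance at 1 and the tail at [t] itself identify both
    norming sequences: with N = N t, (t - b N) / a N tends to 0 and v t / a N tends to 1, and the
    limit along [a], [b] is known on the whole line. *)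
Lemma gumbel_tail_ratio x :
  (1 - F (v t * x + t)) / (1 - F t) @[t --> upto r] --> expR (- x).
Proof.
have [a [b [a0 ab]]] := hD.
have tl y : [set: R] y -> n%:R * (1 - F (a n * y + b n)) @[n --> \oo] --> g y.
  move=> _; apply: expn_expR_cvg; first by move=> n; exact: df_ge0.
  exact: ab y (@continuous_gumbel R y).
have Noo := cvg_tail_index hF cF.
have inj := @tail_inj _ _ hF a b g setT a0 openT tl g_dec _ (upto r) fr N.
have tb : (t - b (N t)) / a (N t) @[t --> upto r] --> (0 : R).
  apply: (inj id) => //; rewrite /g oppr0 expR0; exact: (cvg_tail_index_mul hF cF).
have vb : (t + v t * 1 - b (N t)) / a (N t) @[t --> upto r] --> (1 : R).
  apply: (inj (fun t => t + v t * 1)) => //.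
  by apply/(cvg_tail_ratio hF cF); exact: v_ratio.
have va : v t / a (N t) @[t --> upto r] --> (1 : R).
  have : (t + v t * 1 - b (N t)) / a (N t) - (t - b (N t)) / a (N t) @[t --> upto r]
    --> (1 - 0 : R) by exact: cvgB.
  rewrite subr0; apply: cvg_trans; apply: near_eq_cvg; near=> t.
  by rewrite -mulrBl; congr (_ / _); lra.
apply/(cvg_tail_ratio hF cF (fun t => v t * x + t)).
have := @tail_comp _ _ hF a b g setT a0 openT tl _ (upto r) fr N
  (fun t => (t - b (N t)) / a (N t) + v t / a (N t) * x) x Noo I (@continuous_expRN R x).
have yx : (t - b (N t)) / a (N t) + v t / a (N t) * x @[t --> upto r] --> x.
  rewrite -[X in _ --> X]add0r -[X in _ + X]mul1r.
  by apply: cvgD => //; apply: cvgM => //; exact: cvg_cst.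
move=> /(_ yx); apply: cvg_trans; apply: near_eq_cvg; near=> t => /=.
congr (_ * (1 - F _)).
have : a (N t) != 0 by rewrite gt_eqF.
by move=> h; field.
Unshelve. all: by end_near. Qed.

End Gumbel.

End DomainsOfAttraction.

(** * Domains of attraction of F_k *)

Section RecordDistribution.
Context {R : realType}.
Local Notation h k := (record_df k (@id R)).
Variables (F : R -> R) (k : nat).
Hypotheses (hF : is_df F) (cF : continuous F).
Local Notation r := (right_endpoint F).

Lemma continuous_record_df : continuous (record_df k.+1 F).
Proof. by move=> x; exact: cvg_comp (@cF x) (@continuous_record R k (F x)). Qed.

Lemma record_df_is_df : is_df (record_df k.+1 F).
Proof.
split.
- move=> x y xy; apply: record_nondecreasing; last exact: df_le1.
  exact: df_nondecreasing.
- by move=> x; apply: cvg_at_right_filter; exact: continuous_record_df.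
- have [_ _ F0 _] := hF; have := cvg_comp _ _ F0 (@continuous_record R k 0).
  by rewrite record_id0.
- have [_ _ _ F1] := hF; have := cvg_comp _ _ F1 (@continuous_record R k 1).
  by rewrite record_id1.
Qed.

Lemma eq_right_endpoint (A B : R -> R) :
  (forall x, (A x < 1) = (B x < 1)) -> right_endpoint A = right_endpoint B.
Proof.
by move=> AB; congr ereal_sup; congr image; apply/funext => x /=; rewrite AB.
Qed.

Lemma record_right_endpoint : right_endpoint (record_df k.+1 F) = r.
Proof.
apply: eq_right_endpoint => x; apply/idP/idP => [|Fx1]; last exact: record_lt1.
apply: contraTT; rewrite -!leNgt => F1.
have -> : 1 = F x by apply/eqP; rewrite eq_le F1 df_le1.
suff -> : record_df k.+1 F x = h k.+1 1 by rewrite record_id1 df_le1.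
by rewrite record_dfE; congr (h _ _); apply/eqP; rewrite eq_le F1 df_le1.
Qed.

Lemma record_tail_ratio :
  (1 - record_df k.+1 F x) / (1 - F x) ^+ k.+1 @[x --> upto r] --> (k.+1`!%:R^-1 : R).
Proof.
have F1 := cvg_upto_df hF cF.
apply: (@squeeze_cvgr _ _ _ _ (fun=> k.+1`!%:R^-1)
  (fun x => (F x ^+ k)^-1 * k.+1`!%:R^-1)).
- near=> x.
  have Fx0 : 0 < F x by near: x; apply: (cvgr_gt _ F1).
  have Tx : 0 < (1 - F x) ^+ k.+1.
    by rewrite exprn_gt0//; near: x; exact: near_tail_gt0.
  have Fx1 : F x <= 1 by exact: df_le1.
  have h2 := record_tail_ge k Fx0 Fx1; have h1 := record_tail_le k Fx0 (lexx _) Fx1.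
  rewrite record_dfE ler_pdivlMr// ler_pdivrMr//.
  by rewrite mulrC h2 -mulrA [_^-1 * _ ^+ _]mulrC h1.
- exact: cvg_cst.
- rewrite -[X in _ --> X]mul1r; apply: cvgM; last exact: cvg_cst.
  rewrite -[X in _ --> X]invr1; apply: cvgV => //.
  by have := cvg_comp _ _ F1 (@exprn_continuous R k 1); rewrite expr1n.
Unshelve. all: by end_near. Qed.

Let H (x : R) := 1 - (1 - F x) ^+ k.+1.

Lemma tail_power_is_df : is_df H.
Proof.
have cH : continuous (fun u : R => 1 - (1 - u) ^+ k.+1).
  move=> u; apply: cvgB; first exact: cvg_cst.
  apply: (cvg_comp (fun u : R => 1 - u) (fun u : R => u ^+ k.+1)).
    by apply: cvgB; [exact: cvg_cst|exact: cvg_id].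
  exact: exprn_continuous.
have [_ _ F0 F1] := hF; split.
- move=> x y xy; rewrite lerD2l lerN2.
  by apply: lerXn2r; rewrite ?nnegrE ?subr_ge0 ?df_le1// lerD2l lerN2 df_nondecreasing.
- by move=> x; apply: cvg_at_right_filter; exact: cvg_comp (@cF x) (cH (F x)).
- by have := cvg_comp _ _ F0 (cH 0); rewrite subr0 expr1n subrr.
- by have := cvg_comp _ _ F1 (cH 1); rewrite subrr expr0n/= subr0.
Qed.

Lemma record_tail_equivalent : tail_equivalent (record_df k.+1 F) H.
Proof.
split; [exact: record_df_is_df|exact: tail_power_is_df| |].
  rewrite record_right_endpoint; apply: eq_right_endpoint => x.
  have [F1|F1] := ltP (F x) 1.
    by rewrite /H ltrBlDr ltrDl exprn_gt0 ?subr_gt0.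
  have Fx : F x = 1 by apply/eqP; rewrite eq_le F1 df_le1.
  by rewrite /H Fx; apply/esym/negbTE; rewrite -leNgt subrr expr0n/= subr0.
exists k.+1`!%:R^-1; first by rewrite invr_gt0 ltr0n fact_gt0.
rewrite record_right_endpoint; under eq_cvg do rewrite subKr.
exact: record_tail_ratio.
Qed.

End RecordDistribution.

(** * The explicit norming constants *)

Section NormingConstants.
Context {R : realType}.
Variables (F : R -> R) (k : nat).
Hypotheses (hF : is_df F) (cF : continuous F).
Local Notation r := (right_endpoint F).
Local Notation Fk := (record_df k.+1 F).

(** The tail mass of [F] with n * p n ^+ k.+1 = k.+1! for n > 0; the quantile [t n] below eventually
    realizes it exactly. *)
Let p (n : nat) : R := (k.+1`!%:R / n%:R) `^ k.+1%:R^-1.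

Let pXn n : p n ^+ k.+1 = k.+1`!%:R / n%:R.
Proof. by apply: powR_invnK; apply: divr_ge0; exact: ler0n. Qed.

Let p_cvg0 : p n @[n --> \oo] --> (0 : R).
Proof.
have c0 : k.+1`!%:R / n%:R @[n --> \oo] --> (0 : R).
  have : k.+1`!%:R * n%:R^-1 @[n --> \oo] --> (k.+1`!%:R * 0 : R).
    by apply: cvgM; [exact: cvg_cst|exact: cvg_invn].
  by rewrite mulr0.
apply/cvgrPdist_lt => e e0; near=> n.
rewrite sub0r normrN ger0_norm ?powR_ge0//.
rewrite -(@ltr_pXn2r _ k.+1) ?nnegrE ?powR_ge0 ?(ltW e0)// pXn.
by near: n; apply: (cvgr_lt _ c0); rewrite exprn_gt0.
Unshelve. all: by end_near. Qed.

Let t (n : nat) : R := quantile F (1 - p n).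

Let tP : t n @[n --> \oo] --> upto r /\
  n%:R * (1 - F (t n)) ^+ k.+1 @[n --> \oo] --> (k.+1`!%:R : R).
Proof.
have [|Ft tr] := cvg_quantile_upto hF cF _ p_cvg0.
  near=> n; apply/andP; split; last by near: n; exact: (cvgr_lt _ p_cvg0).
  rewrite powR_gt0// divr_gt0// ltr0n ?fact_gt0//; near: n; exact: nbhs_infty_gt.
split => //; apply: cvg_near_cst; near=> n.
have -> : F (t n) = 1 - p n by near: n.
rewrite opprB addrC subrK pXn mulrC divfK// pnatr_eq0 -lt0n; near: n.
exact: nbhs_infty_gt.
Unshelve. all: by end_near. Qed.

Lemma frechet_norming alpha : 0 < alpha -> in_Dl F (frechet alpha) ->
  cvg_under_norming Fk (frechet (k.+1%:R * alpha)) t (fun=> 0).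
Proof.
move=> alpha0 hD; have [tr tk] := tP.
have rE := frechet_endpoint hF cF alpha0 hD.
have t0 : \forall n \near \oo, 0 < t n.
  have : \forall y \near upto r, 0 < y.
    by rewrite rE /=; exact: nbhs_pinfty_gt.
  by move/tr.
have pos x : 0 < x ->
    Fk (t n * x) ^+ n @[n --> \oo] --> expR (- (x `^ (- (k.+1%:R * alpha)))).
  move=> x0; have ratio := frechet_tail_ratio hF cF alpha0 hD x0.
  rewrite -mulrN -powRXn.
  exact: (@record_norming _ F hF cF k t (fun y => y * x) _ ratio tr tk).
split => // x; rewrite /frechet; under eq_cvg do rewrite addr0.
case: ltP => [|x0]; first exact: pos.
have hFk := record_df_is_df k hF cF.
apply/cvgrPdist_lt => e e0.
(* For x <= 0 the powers are dominated by those at a small [x1 > 0], chosen so that the Frechet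
   limit at [x1] is exp(-y) < e; the maximum keeps [y] positive. *)
pose y := Num.max 1 (1 - ln e).
have y0 : 0 < y by rewrite lt_max ltr01.
have ye : expR (- y) < e.
  rewrite -[ltRHS](lnK e0) ltr_expR ltrNl lt_max; apply/orP; right.
  by lra.
have ka : 0 < k.+1%:R * alpha by rewrite mulr_gt0.
pose x1 := y `^ (- (k.+1%:R * alpha)^-1).
have x10 : 0 < x1 by rewrite powR_gt0.
have := pos x1 x10; rewrite -powRrM mulrNN mulVf ?gt_eqF// powRr1 ?(ltW y0)// => c1.
near=> n; rewrite sub0r normrN ger0_norm ?exprn_ge0 ?df_ge0//.
apply: (@le_lt_trans _ _ (Fk (t n * x1) ^+ n)).
  apply: lerXn2r; rewrite ?nnegrE ?df_ge0//; apply: df_nondecreasing => //.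
  rewrite ler_wpM2l ?(le_trans x0) ?ltW//; near: n; exact: t0.
by near: n; exact: (cvgr_lt _ c1).
Unshelve. all: by end_near. Qed.

Lemma weibull_norming alpha : 0 < alpha -> in_Dl F (weibull alpha) ->
  cvg_under_norming Fk (weibull (k.+1%:R * alpha)) (fun n => fine r - t n) (fun=> fine r).
Proof.
move=> alpha0 hD; have [tr tk] := tP.
have rfin := weibull_endpoint hF cF alpha0 hD.
have rE : r = (fine r)%:E.
  by rewrite fineK// fin_numElt rfin (right_endpoint_gtNy hF cF).
have t0 : \forall n \near \oo, 0 < fine r - t n.
  have tr1 : \forall n \near \oo, F (t n) < 1 by exact: tr _ (upto_lt1 hF cF).
  by near=> n; rewrite subr_gt0 -lte_fin -rE lt_right_endpoint//; near: n.
split => // x; rewrite /weibull; case: ltP => [xlt0|x0].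
  have ratio := weibull_tail_ratio hF cF alpha0 hD xlt0.
  rewrite -powRXn.
  exact: (@record_norming _ F hF cF k t (fun y => (fine r - y) * x + fine r) _ ratio tr tk).
(* For x >= 0 the argument is at or beyond the right endpoint, where [F], hence F_k, equals 1. *)
apply: cvg_near_cst; near=> n.
suff -> : Fk ((fine r - t n) * x + fine r) = 1 by rewrite expr1n.
rewrite record_dfE (_ : F _ = 1) ?record_id1//.
apply/eqP; rewrite eq_le df_le1//= leNgt -lt_right_endpoint// rE lte_fin -leNgt.
rewrite lerDr mulr_ge0//; apply: ltW; near: n; exact: t0.
Unshelve. all: by end_near. Qed.

Section Gumbel.
Variables (v : R -> R) (hD : in_Dl F (@gumbel R)).
Hypothesis v_gt0 : forall y, (y%:E < r)%E -> 0 < v y.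
Hypothesis v_ratio : forall x, 0 <= x ->
  (1 - F (y + v y * x)) / (1 - F y) @[y --> upto r] --> expR (- x).

Let near_v (s : nat -> R) : s n @[n --> \oo] --> upto r ->
  \forall n \near \oo, 0 < v (s n).
Proof.
move=> sr; have sr1 : \forall n \near \oo, F (s n) < 1 by exact: sr _ (upto_lt1 hF cF).
by near=> n; apply: v_gt0; rewrite lt_right_endpoint//; near: n.
Unshelve. all: by end_near. Qed.

Let near_inv01 : \forall n \near \oo, 0 < (n%:R^-1 : R) < 1.
Proof.
near=> n; rewrite invr_gt0 ltr0n invf_lt1 ?ltr1n ?ltr0n; last first.
  by near: n; exact: nbhs_infty_gt.
by apply/andP; split; near: n; exact: nbhs_infty_gt.
Unshelve. all: by end_near. Qed.

Lemma gumbel_norming :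
  cvg_under_norming F (@gumbel R) (fun n => v (quantile F (1 - n%:R^-1)))
    (fun n => quantile F (1 - n%:R^-1)).
Proof.
have [Fs sr] := cvg_quantile_upto hF cF near_inv01 (@cvg_invn R).
split; first exact: near_v.
move=> x; have ratio := gumbel_tail_ratio hF cF hD (@v_ratio) (x := x).
apply: (@norming _ F hF cF _ (fun y => v y * x + y) _ ratio sr).
apply: cvg_near_cst; near=> n.
have -> : F (quantile F (1 - n%:R^-1)) = 1 - n%:R^-1 by near: n.
rewrite opprB addrC subrK divff// pnatr_eq0 -lt0n; near: n; exact: nbhs_infty_gt.
Unshelve. all: by end_near. Qed.

Lemma record_gumbel_norming :
  cvg_under_norming Fk (@gumbel R) (fun n => v (quantile Fk (1 - n%:R^-1)) / k.+1%:R)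
    (fun n => quantile Fk (1 - n%:R^-1)).
Proof.
have hFk := record_df_is_df k hF cF.
have cFk : continuous Fk by exact: continuous_record_df.
have [Fs sr] := cvg_quantile_upto hFk cFk near_inv01 (@cvg_invn R).
rewrite record_right_endpoint// in sr.
set s := fun n : nat => quantile Fk (1 - n%:R^-1) in sr *.
split; first by near=> n; rewrite divr_gt0//; near: n; exact: near_v.
move=> x.
have f0 : k.+1`!%:R^-1 != 0 :> R by rewrite invr_eq0 pnatr_eq0 -lt0n fact_gt0.
(* Here [s n] is a quantile of F_k, with n * (1 - Fk (s n)) = 1 for large n; inverting the tail
   ratio of F_k to the power of the tail of [F] yields the factorial. *)
have sk : n%:R * (1 - F (s n)) ^+ k.+1 @[n --> \oo] --> (k.+1`!%:R : R).
  have : ((1 - Fk (s n)) / (1 - F (s n)) ^+ k.+1)^-1 @[n --> \oo]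
      --> ((k.+1`!%:R : R)^-1)^-1.
    by apply: cvgV => //; exact: cvg_comp sr (record_tail_ratio hF cF).
  rewrite invrK; apply: cvg_trans; apply: near_eq_cvg; near=> n.
  have -> : Fk (s n) = 1 - n%:R^-1 by near: n.
  by rewrite opprB addrC subrK invf_div invrK mulrC.
have ratio := gumbel_tail_ratio hF cF hD (@v_ratio) (x := x / k.+1%:R).
(* The tail ratio of [F] is taken at x / k.+1, because its limit is raised to the power k.+1; this
   is the origin of the scale v / k.+1. *)
have xE : expR (- x) = expR (- (x / k.+1%:R)) ^+ k.+1.
  by rewrite -expRM_natl mulrN mulrCA divff ?pnatr_eq0// mulr1.
rewrite /gumbel xE; under eq_cvg do rewrite mulrAC -[v _ * x / _]mulrA.
exact: (@record_norming _ F hF cF k s (fun y => v y * (x / k.+1%:R) + y) _ ratio sr sk).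
Unshelve. all: by end_near. Qed.

End Gumbel.

End NormingConstants.

Unset Implicit Arguments.
Set Strict Implicit.

Theorem theorem2p4 (R : realType) (F f : R -> R) (k : nat)
    (hF : is_df F) (hf : is_pdf F f) (hk : (0 < k)%N) :
  let Fk := record_df k F in
  let r := right_endpoint F in
  (* (a) *)
  [/\ is_df Fk, right_endpoint Fk = r, is_pdf Fk (record_pdf k F f),
      (1 - Fk x) / (1 - F x) ^+ k @[x --> upto r] --> (k`!%:R^-1 : R) &
      tail_equivalent Fk (fun x => 1 - (1 - F x) ^+ k)] /\
  (* (b) *)
  (forall alpha : R, 0 < alpha -> in_Dl F (frechet alpha) ->
    [/\ right_endpoint Fk = r, r = +oo%E,
        in_Dl Fk (frechet (k%:R * alpha)) &
        cvg_under_norming Fk (frechet (k%:R * alpha))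
          (fun n => quantile F (1 - (k`!%:R / n%:R) `^ (k%:R^-1)))
          (fun=> 0)]) /\
  (* (c) *)
  (forall alpha : R, 0 < alpha -> in_Dl F (weibull alpha) ->
    [/\ right_endpoint Fk = r, (r < +oo)%E,
        in_Dl Fk (weibull (k%:R * alpha)) &
        cvg_under_norming Fk (weibull (k%:R * alpha))
          (fun n => fine r - quantile F (1 - (k`!%:R / n%:R) `^ (k%:R^-1)))
          (fun=> fine r)]) /\
  (* (d) *)
  (forall v : R -> R, in_Dl F (@gumbel R) ->
    (forall t, (t%:E < r)%E -> 0 < v t) ->
    (forall x, 0 <= x ->
      (1 - F (t + v t * x)) / (1 - F t) @[t --> upto r] --> expR (- x)) ->
    [/\ cvg_under_norming F (@gumbel R)
          (fun n => v (quantile F (1 - n%:R^-1)))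
          (fun n => quantile F (1 - n%:R^-1)),
        right_endpoint Fk = r,
        in_Dl Fk (@gumbel R) &
        cvg_under_norming Fk (@gumbel R)
          (fun n => v (quantile Fk (1 - n%:R^-1)) / k%:R)
          (fun n => quantile Fk (1 - n%:R^-1))]).
Proof.
case: k hk => [hk|k _]; first by exfalso; move: hk; rewrite ltnn.
have cF := pdf_continuous hF hf.
have rE : right_endpoint (record_df k.+1 F) = right_endpoint F.
  exact: record_right_endpoint.
split.
  split; [exact: record_df_is_df|exact: rE|exact: record_pdfP|
    exact: record_tail_ratio|exact: record_tail_equivalent].
split.
  move=> alpha alpha0 hD.
  have norm : cvg_under_norming (record_df k.+1 F) (frechet (k.+1%:R * alpha))
      (fun n => quantile F (1 - (k.+1`!%:R / n%:R) `^ (k.+1%:R^-1))) (fun=> 0).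
    exact: frechet_norming.
  split; [exact: rE|exact: frechet_endpoint hD| |exact: norm].
  exact: cvg_under_norming_in_Dl norm.
split.
  move=> alpha alpha0 hD.
  have norm : cvg_under_norming (record_df k.+1 F) (weibull (k.+1%:R * alpha))
      (fun n => fine (right_endpoint F)
        - quantile F (1 - (k.+1`!%:R / n%:R) `^ (k.+1%:R^-1)))
      (fun=> fine (right_endpoint F)).
    exact: weibull_norming.
  split; [exact: rE|exact: weibull_endpoint hD| |exact: norm].
  exact: cvg_under_norming_in_Dl norm.
move=> v hD v0 vr.
have norm : cvg_under_norming (record_df k.+1 F) (@gumbel R)
    (fun n => v (quantile (record_df k.+1 F) (1 - n%:R^-1)) / k.+1%:R)
    (fun n => quantile (record_df k.+1 F) (1 - n%:R^-1)).
  exact: record_gumbel_norming.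
split; [exact: gumbel_norming|exact: rE|exact: cvg_under_norming_in_Dl norm|exact: norm].
Qed.
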